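(* Let $f:\mathbb{R}^{+}\rightarrow\mathbb{R}$ be a bounded measurable function and let $t\in\mathbb{R}^{+}$ be a non-removable jump discontinuity point of $f$. For any $\alpha \in \mathbb{R}$ and any kernel $\chi:\mathbb{R}^+\to\mathbb{R}$ satisfying the additional condition $\chi(u)=0$ for every $u\in[1,e)$, the following statements (i), (ii) and (iii) are equivalent: (i) $\displaystyle \lim_{w \rightarrow \infty}(I_w^{\chi}f)(t)=\alpha f(t+0)+(1-\alpha)f(t-0)$; (ii) $\psi_{\chi}^{-}(u)=\alpha$ for every $u \in[1, e)$; (iii) $\psi_{\chi}^{+}(u)=1-\alpha$ for every $u\in[1, e)$. If, in addition, $\chi$ is continuous on $\mathbb{R}^{+}$, then statements (i), (ii) and (iii) of this theorem are also equivalent to each of the following: (iv) for every $k\in\mathbb{Z}$, $\displaystyle\int_{0}^{1} \chi (u)\, u^{2k\pi i}\,\frac{du}{u}$ equals $0$ if $k\neq0$ and equals $\alpha$ if $k=0$; (v) for every $k\in\mathbb{Z}$, $\displaystyle\int_{1}^{\infty} \chi (u)\, u^{2k\pi i }\,\frac{du}{u}$ equals $0$ if $k\neq0$ and equals $1-\alpha$ if $k=0$.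
   Context: $\mathbb{R}^+$ denotes the positive real numbers. A function $\chi:\mathbb{R}^+\to\mathbb{R}$ is called a kernel if: (i) $\chi\in L^1(\mathbb{R}^+)$ and $\chi$ is bounded on $[1/e,e]$; (ii) $\sum_{k=-\infty}^{+\infty}\chi(e^{-k}u)=1$ for every $u\in\mathbb{R}^+$; (iii) for some $\nu>0$, $\sup_{u\in\mathbb{R}^+}\sum_{k=-\infty}^{+\infty}|\chi(e^{-k}u)|\,|k-\log u|^{\nu}<+\infty$. For $w>0$ and bounded measurable $f:\mathbb{R}^+\to\mathbb{R}$, the Kantorovich exponential sampling series is \[(I_{w}^{\chi}f)(x)= \sum_{k= - \infty}^{+\infty} \chi(e^{-k} x^{w})\, w \int_{k/w}^{(k+1)/w} f(e^{u})\, du,\quad x\in\mathbb{R}^+.\] The one-sided limits are $f(t+0):=\lim_{y\to0^+}f(t+y)$ and $f(t-0):=\lim_{y\to0^+}f(t-y)$; $t$ is a non-removable jump discontinuity point of $f$ if both exist, are finite, and are different. For $u\in\mathbb{R}^+$, $\psi_\chi^+(u):=\sum_{k\in\mathbb{Z},\,k<\log u}\chi(ue^{-k})$ and $\psi_\chi^-(u):=\sum_{k\in\mathbb{Z},\,k>\log u}\chi(ue^{-k})$.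
   Formalization: The implication from (i) to (ii) is stated only for t ≠ 1: at t = 1 one has t^w = 1 for all w, so (i) only determines ψ⁻(1) and the claimed implication fails; all other implications hold for every t > 0. *)

(* Defs.v *)
From mathcomp Require Import all_boot all_order all_algebra.
From mathcomp Require Import complex.
From mathcomp Require Import all_classical all_reals all_analysis.

Set Implicit Arguments.
Unset Strict Implicit.
Unset Printing Implicit Defensive.

Import Order.TTheory GRing.Theory Num.Theory.
Import numFieldNormedType.Exports.

Local Open Scope classical_set_scope.
Local Open Scope ring_scope.

(** Functions on the positive half-line are represented by functions [R -> R]
    of which only the values on [Rpos] are ever used. *)
Definition Rpos (R : realType) : set R := `]0, +oo[.

(** [R] with the sigma-algebra of all Lebesgue-measurable sets (the canonical
    measurable structure of [R] itself is the Borel one). *)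
Definition lebesgueR (R : realType) :=
  caratheodory_type ((wlength (@idfun R))^*)%mu.

Definition leb (R : realType) : {measure set (lebesgueR R) -> \bar R} :=
  @completed_lebesgue_measure R.

Definition lebesgue_measurable_fun (R : realType) (D : set R) (g : R -> R) :=
  measurable_fun (D : set (lebesgueR R)) (g : lebesgueR R -> R).

Definition L1 (R : realType) (D : set R) (g : R -> R) :=
  (@leb R).-integrable (D : set (lebesgueR R)) (EFin \o g).

Definition lebint (R : realType) (D : set R) (g : R -> R) : R :=
  Rintegral (@leb R) (D : set (lebesgueR R)) g.

Definition lebintC (R : realType) (D : set R) (g : R -> R[i]) : R[i] :=
  (lebint D (fun u => complex.Re (g u)) +i*
   lebint D (fun u => complex.Im (g u)))%C.

(** Sum over all integers: the terms [a 0, a 1, ...] and, [Negz n] being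
    [- n.+1], the terms [a (-1), a (-2), ...]; both halves must converge for
    the value to be meaningful. *)
Definition cvg_zsum (R : realType) (a : int -> R) : Prop :=
  cvgn (series (fun n => a (Posz n))) /\ cvgn (series (fun n => a (Negz n))).

Definition zsum (R : realType) (a : int -> R) : R :=
  limn (series (fun n => a (Posz n))) + limn (series (fun n => a (Negz n))).

Definition is_kernel (R : realType) (chi : R -> R) : Prop :=
  [/\ L1 (@Rpos R) chi,
      [bounded chi u | u in `[(expR 1)^-1, expR 1]],
      forall u, Rpos u ->
        cvg_zsum (fun k => chi (expR (- k%:~R) * u)) /\
        zsum (fun k => chi (expR (- k%:~R) * u)) = 1
    & exists2 nu : R, 0 < nu &
        (ereal_sup [set \esum_(k in [set: int])
             (`|chi (expR (- k%:~R) * u)| * `|k%:~R - ln u| `^ nu)%:E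
           | u in @Rpos R] < +oo)%E].

Definition Kantorovich (R : realType) (chi f : R -> R) (w x : R) : R :=
  zsum (fun k => chi (expR (- k%:~R) * x `^ w) *
    (w * lebint `[k%:~R / w, (k%:~R + 1) / w] (fun u => f (expR u)))).

Definition right_lim (R : realType) (f : R -> R) (t : R) : R :=
  lim (f (t + y) @[y --> 0^'+]).

Definition left_lim (R : realType) (f : R -> R) (t : R) : R :=
  lim (f (t - y) @[y --> 0^'+]).

Definition jump_discontinuity (R : realType) (f : R -> R) (t : R) : Prop :=
  [/\ cvg (f (t + y) @[y --> 0^'+]), cvg (f (t - y) @[y --> 0^'+])
    & right_lim f t <> left_lim f t].

Definition psi_plus (R : realType) (chi : R -> R) (u : R) : R :=
  zsum (fun k => if k%:~R < ln u then chi (u * expR (- k%:~R)) else 0).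

Definition psi_minus (R : realType) (chi : R -> R) (u : R) : R :=
  zsum (fun k => if k%:~R > ln u then chi (u * expR (- k%:~R)) else 0).

Definition cexp (R : realType) (z : R[i]) : R[i] :=
  ((expR (complex.Re z))%:C *
   (cos (complex.Im z) +i* sin (complex.Im z)))%C.

(** [u ^ z] is only meaningful for [u > 0]. *)
Definition cpow (R : realType) (u : R) (z : R[i]) : R[i] :=
  cexp (z * (ln u)%:C)%C.

Definition mellin_coef (R : realType) (D : set R) (chi : R -> R) (k : int)
    : R[i] :=
  lebintC D (fun u =>
    (chi u)%:C * cpow u (0 +i* (2 * k%:~R * pi)) / u%:C)%C.

(* Main.v *)
Require Import Defs.
From mathcomp Require Import all_boot all_order all_algebra.
From mathcomp Require Import complex.
From mathcomp Require Import all_classical all_reals all_analysis.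
From mathcomp Require Import measurable_realfun.
From mathcomp Require Import zify ring lra.

Import Order.TTheory GRing.Theory Num.Theory.
Import numFieldNormedType.Exports.

Local Open Scope classical_set_scope.
Local Open Scope ring_scope.

Set Implicit Arguments.
Unset Strict Implicit.
Unset Printing Implicit Defensive.

(** Since [chi] vanishes on [[1, e)], no term of the series at [t] averages [f]
    across the jump: the index [k] with [k <= w log t < k + 1] does not
    contribute. The moment condition makes the far indices negligible, so the
    indices [k > w log t] contribute [psi^-(t^w) f(t+0)] and the others
    [psi^+(t^w) f(t-0)], up to [o(1)]. As [psi^- + psi^+ = 1] and [psi^-] is
    invariant under [u -> e u], the limits (i) and the identities (ii), (iii)
    are equivalent; when [t <> 1] the points [t^w] visit every class [u e^Z].

    If [chi] is continuous, [s -> psi^-(e^s)] agrees on [[0, 1)] with the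
    continuous function [sum_(k >= 1) chi(e^(s - k))], whose Fourier
    coefficients are, by the substitution [u = e^(s - k)] on each
    [[e^-k, e^(1 - k))], the Mellin integrals of (iv). A continuous function
    on [[0, 1]] is determined on [[0, 1)] by its Fourier coefficients. The same
    applies to [psi^+] and (v). *)

(** * Lebesgue integrals *)

Lemma measurable_leb (R : realType) (A : set R) :
  measurable (A : set (measurableTypeR R)) -> measurable (A : set (lebesgueR R)).
Proof. exact: sub_caratheodory. Qed.

Lemma measurable_fun_id_leb (R : realType) :
  measurable_fun [set: lebesgueR R]
    (fun x : lebesgueR R => (x : measurableTypeR R)).
Proof. by move=> _ A mA; rewrite setTI; exact: measurable_leb. Qed.

(** The identity from the completed sigma-algebra to the Borel one is measurable, and the
    pushforward of [leb] along it is the Lebesgue measure by conversion. *)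
Lemma ge0_integral_leb (R : realType) (D : set R) (g : R -> \bar R) :
  measurable D -> measurable_fun D g -> (forall x, D x -> (0 <= g x)%E) ->
  (integral (@leb R) D g =
   \int[lebesgue_measure]_(x in D) g x)%E.
Proof.
move=> mD mg g0; transitivity
  (\int[pushforward (@leb R) (fun x : lebesgueR R => (x : measurableTypeR R))]_(x in D) g x)%E.
  rewrite (ge0_integral_pushforward (@measurable_fun_id_leb R) _ mD mg)//.
  by move=> x; rewrite inE; exact: g0.
by [].
Qed.

Lemma integral_leb (R : realType) (D : set R) (g : R -> \bar R) :
  measurable D -> measurable_fun D g ->
  (integral (@leb R) D g =
   \int[lebesgue_measure]_(x in D) g x)%E.
Proof.
move=> mD mg; rewrite integralE [RHS]integralE !ge0_integral_leb//.
  exact: measurable_funeneg.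
exact: measurable_funepos.
Qed.

Lemma lebint_Borel (R : realType) (D : set R) (g : R -> R) :
  measurable D -> measurable_fun D g ->
  lebint D g = \int[lebesgue_measure]_(x in D) g x.
Proof.
by move=> mD mg; rewrite /lebint /Rintegral integral_leb//; exact/measurable_EFinP.
Qed.

(* No measurability is needed: the integral is defined as a supremum over the
   simple functions below the integrand. *)
Lemma le_integral_nonmeasurable d (T : measurableType d) (R : realType)
    (mu : {measure set T -> \bar R}) (D : set T) (f g : T -> \bar R) :
  (forall x, D x -> (f x <= g x)%E) ->
  (\int[mu]_(x in D) f x <= \int[mu]_(x in D) g x)%E.
Proof.
have ge0_le (h k : T -> \bar R) : (forall x, D x -> (0 <= h x)%E) ->
    (forall x, D x -> (h x <= k x)%E) ->
    (\int[mu]_(x in D) h x <= \int[mu]_(x in D) k x)%E.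
  move=> h0 hk; rewrite !ge0_integralE//; last first.
    by move=> x Dx; rewrite (le_trans (h0 _ Dx))// hk.
  apply: le_ereal_sup => _ [p ph <-]; exists p => // x.
  apply: (le_trans (ph x)); rewrite /patch; case: ifPn => //.
  by rewrite inE; exact: hk.
move=> fg; rewrite integralE [leRHS]integralE leeB// ge0_le// => x Dx.
  by apply: (@funepos_le _ _ D) => //; [move=> y /set_mem; exact: fg|exact: mem_set].
by apply: (@funeneg_le _ _ D) => //; [move=> y /set_mem; exact: fg|exact: mem_set].
Qed.

(** The exceptional value [d] at [b] lets bounds known only on [[a, b)] control an integral over
    [[a, b]]: a window ending at the jump gives no information at its endpoint. *)
Lemma integral_leb_itv_cst (R : realType) (a b c d : R) : a <= b ->
  (integral (@leb R) `[a, b]%classic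
     (fun x => (if x == b then d else c)%:E) = (c * (b - a))%:E)%E.
Proof.
move=> ab; have m_ D : measurable_fun D (fun x : R => if x == b then d else c).
  apply: measurable_funTS; apply: measurable_fun_ifT => //.
  by apply: measurable_fun_eqr; [exact: measurable_id|exact: measurable_cst].
rewrite integral_leb//; last exact/measurable_EFinP.
rewrite -integral_itv_bndo_bndc; last exact/measurable_EFinP.
rewrite (eq_integral (cst c%:E)); last first.
  move=> x; rewrite inE/= in_itv/= => /andP[_ xb].
  by rewrite (lt_eqF xb).
by rewrite integral_cst//= lebesgue_measure_itv/= lte_fin; case: ltgtP ab => //= -> _; rewrite subrr mulr0 mule0.
Qed.

Lemma lebint_itv_bounds (R : realType) (g : R -> R) (a b m M : R) : a <= b ->
  (forall x, a <= x < b -> m <= g x <= M) ->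
  m * (b - a) <= lebint `[a, b] g <= M * (b - a).
Proof.
move=> ab gmM; rewrite /lebint /Rintegral.
set I := (X in fine X).
have lb : ((m * (b - a))%:E <= I)%E.
  rewrite -(integral_leb_itv_cst _ (g b) ab); apply: le_integral_nonmeasurable.
  move=> x /=; rewrite in_itv/= lee_fin => /andP[ax xb].
  case: eqP => [->//|/eqP xneb]; have/andP[]// : m <= g x <= M.
  by apply: gmM; rewrite ax lt_neqAle xneb.
have ub : (I <= (M * (b - a))%:E)%E.
  rewrite -(integral_leb_itv_cst _ (g b) ab); apply: le_integral_nonmeasurable.
  move=> x /=; rewrite in_itv/= lee_fin => /andP[ax xb].
  case: eqP => [->//|/eqP xneb]; have/andP[]// : m <= g x <= M.
  by apply: gmM; rewrite ax lt_neqAle xneb.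
(* Two finite bounds exclude the infinite values of [I], on which [fine] would return the default
   0. *)
move: lb ub; case: I => //= r; rewrite !lee_fin => -> ->//.
Qed.

Lemma lebint_itv_near (R : realType) (g : R -> R) (a b c e : R) : a <= b ->
  (forall x, a <= x < b -> `|g x - c| <= e) ->
  `|lebint `[a, b] g - c * (b - a)| <= e * (b - a).
Proof.
move=> ab ge; have /(lebint_itv_bounds ab) : forall x, a <= x < b ->
    c - e <= g x <= c + e.
  by move=> x /ge; rewrite ler_distl.
by rewrite ler_distl -mulrDl -mulrBl.
Qed.

(** * Sums over the integers *)

Lemma is_cvg_series_bounded (R : realType) (a : nat -> R) (B : R) :
  (forall N, \sum_(n < N) `|a n| <= B) ->
  cvgn (series a) /\ `|limn (series a)| <= B.
Proof.
move=> aB; have ca : cvgn [normed series a].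
  apply: nondecreasing_is_cvgn.
    by apply: nondecreasing_series => n _ _; exact: normr_ge0.
  by exists B => _ [n _ <-]; have := aB n; rewrite -(big_mkord xpredT (fun k => `|a k|)).
split; first exact: normed_cvg.
apply: (le_trans (lim_series_norm ca)); apply: limr_le => //.
by apply: nearW => n; have := aB n; rewrite -(big_mkord xpredT (fun k => `|a k|)).
Qed.

(** Quantifying over injective [sg] bounds every sum over finitely many distinct indices. [Posz] and
    [Negz] are two such enumerations, each costing one [B]. *)
Lemma zsum_bounded (R : realType) (a : int -> R) (B : R) :
  (forall sg : nat -> int, injective sg -> forall N,
    \sum_(n < N) `|a (sg n)| <= B) ->
  cvg_zsum a /\ `|zsum a| <= B + B.
Proof.
move=> aB; have [|cp lp] := @is_cvg_series_bounded R (fun n => a (Posz n)) B.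
  by apply: aB => m n [].
have [|cn ln] := @is_cvg_series_bounded R (fun n => a (Negz n)) B.
  by apply: aB => m n [].
split => //; rewrite /zsum; apply: (le_trans (ler_normD _ _)); exact: lerD.
Qed.

Lemma cvg_zsumD (R : realType) (a b : int -> R) : cvg_zsum a -> cvg_zsum b ->
  cvg_zsum (fun k => a k + b k) /\ zsum (fun k => a k + b k) = zsum a + zsum b.
Proof.
move=> [ap an] [bp bn]; have [cp cn] := (is_cvg_seriesD ap bp, is_cvg_seriesD an bn).
split=> //.
by rewrite /zsum (lim_seriesD ap bp) (lim_seriesD an bn) addrACA.
Qed.

Lemma cvg_zsumZ (R : realType) (c : R) (a : int -> R) : cvg_zsum a ->
  cvg_zsum (fun k => c * a k) /\ zsum (fun k => c * a k) = c * zsum a.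
Proof.
move=> [ap an]; split; first by split; exact: is_cvg_seriesZ.
by rewrite /zsum (lim_seriesZ c ap) (lim_seriesZ c an) mulrDr.
Qed.

(** The shift moves [a 0] from the nonnegative half to the negative one and otherwise only renumbers
    the terms. *)
Lemma cvg_zsum_shift1 (R : realType) (a : int -> R) : cvg_zsum a ->
  cvg_zsum (fun k => a (k + 1)) /\ zsum (fun k => a (k + 1)) = zsum a.
Proof.
move=> [/cvg_ex[/= p ap] /cvg_ex[/= q an]].
have cp : series (fun n => a (n%:Z + 1)) @ \oo --> p - a 0.
  rewrite (_ : series _ = (fun n => series (fun n => a (Posz n)) n.+1 - a 0)).
    by apply: cvgB; [rewrite (cvg_shiftS (series _))|exact: cvg_cst].
  apply/funext => n; rewrite /series/= big_nat_recl//= addrAC subrr add0r.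
  by apply: eq_bigr => i _; rewrite -addn1 PoszD.
have cn : series (fun n => a (Negz n + 1)) @ \oo --> q + a 0.
  rewrite -(cvg_shiftS (series _)).
  rewrite (_ : [sequence _]_n = (fun n => series (fun n => a (Negz n)) n + a 0)).
    by apply: cvgD => //; exact: cvg_cst.
  apply/funext => n; rewrite /series/= big_nat_recl//= addrC NegzE addNr; congr (_ + _).
  by apply: eq_bigr => i _; congr a; rewrite !NegzE -[i.+2]addn1 PoszD; ring.
split; first by split; [apply/cvg_ex; exists (p - a 0)|apply/cvg_ex; exists (q + a 0)].
rewrite /zsum (cvg_lim _ cp)// (cvg_lim _ cn)// (cvg_lim _ ap)// (cvg_lim _ an)//.
by ring.
Qed.

Lemma cvg_zsum_shift (R : realType) (m : nat) (a : int -> R) : cvg_zsum a ->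
  cvg_zsum (fun k => a (k + m%:Z)) /\ zsum (fun k => a (k + m%:Z)) = zsum a.
Proof.
move=> ca; elim: m => [|m [ch eh]].
  by rewrite (_ : (fun k => _) = a)//; apply/funext => k; rewrite addr0.
have [] := cvg_zsum_shift1 ch.
rewrite eh (_ : (fun k => _) = (fun k => a (k + m.+1%:Z)))//.
by apply/funext => k; congr a; rewrite -[m.+1]addn1 PoszD; ring.
Qed.

(** * Kernels *)

Lemma Rpos_gt0 (R : realType) (u : R) : Rpos u <-> 0 < u.
Proof. by rewrite /Rpos/= in_itv/= andbT. Qed.

(** [\esum] is a supremum over finite sets of indices, so it dominates each sum over distinct
    [sg n]; the finite supremum over [u] serves as [M]. *)
Lemma kernel_moment (R : realType) (chi : R -> R) : is_kernel chi ->
  exists nu M : R, [/\ 0 < nu, 0 <= M & forall u : R, 0 < u ->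
    forall sg : nat -> int, injective sg -> forall N,
    \sum_(n < N) `|chi (expR (- (sg n)%:~R) * u)| *
      `|(sg n)%:~R - ln u| `^ nu <= M].
Proof.
move=> [_ _ _ [nu nu0 supM]]; exists nu.
set S := ereal_sup _ in supM.
have le_S u : 0 < u -> forall sg : nat -> int, injective sg -> forall N,
    ((\sum_(n < N) `|chi (expR (- (sg n)%:~R) * u)| *
      `|(sg n)%:~R - ln u| `^ nu)%:E <= S)%E.
  move=> u0 sg inj_sg N.
  apply: (@le_trans _ _ (\esum_(k in [set: int])
    (`|chi (expR (- k%:~R) * u)| * `|k%:~R - ln u| `^ nu)%:E)%E); last first.
    by apply: ereal_sup_ubound; exists u => //; exact/Rpos_gt0.
  apply: esum_ge; exists [set` [seq sg n | n <- iota 0 N]].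
    by split=> //; exact: finite_seq.
  rewrite -fsbig_seq/=; last by rewrite map_inj_uniq ?iota_uniq.
  by rewrite big_map -sumEFin -[X in iota _ X]subn0 -/(index_iota 0 N) big_mkord.
(* The empty sum is among those bounded by [S]. *)
have S0 : (0 <= S)%E.
  by have := @le_S 1 ltr01 Posz (fun _ _ => fun '(erefl) => erefl) 0; rewrite big_ord0.
exists (fine S); split => //; first exact: fine_ge0.
move=> u u0 sg inj_sg N; rewrite -lee_fin fineK ?le_S//.
by rewrite ge0_fin_numE.
Qed.

(* Only the index [floor (ln u) + 1] needs the bound on [1/e, e]: the moment
   condition controls the indices at distance at least 1 from [ln u], and
   [chi0] kills the index [floor (ln u)]. *)
Lemma kernel_sum (R : realType) (chi : R -> R) : is_kernel chi ->
  (forall u, 1 <= u < expR 1 -> chi u = 0) ->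
  exists A : R, 0 <= A /\ forall u : R, 0 < u ->
    forall sg : nat -> int, injective sg -> forall N,
    \sum_(n < N) `|chi (expR (- (sg n)%:~R) * u)| <= A.
Proof.
move=> chiK chi0; have [nu [M [nu0 M0 momM]]] := kernel_moment chiK.
case: chiK => _ [B [_ bndB]] _ _.
(* Boundedness supplies every constant strictly above [B], such as [B + 1]; the maximum keeps [C]
   nonnegative. *)
pose C := Num.max 1 (B + 1).
have C0 : 0 <= C by rewrite le_max ler01.
have chiC u : (expR 1)^-1 <= u <= expR 1 -> `|chi u| <= C.
  move=> uI; apply: (@le_trans _ _ (B + 1)); last by rewrite le_max lexx orbT.
  by apply: (bndB (B + 1)); [rewrite ltrDl|rewrite /= in_itv].
exists (M + C); split; first exact: addr_ge0.
move=> u u0 sg inj_sg N.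
pose m := Num.floor (ln u).
have mu : (m%:~R : R) <= ln u by exact: floor_le.
have um : ln u < (m%:~R : R) + 1 by rewrite -intrD1 floorD1_gt.
have le_term k : `|chi (expR (- k%:~R) * u)| <=
    `|chi (expR (- k%:~R) * u)| * `|k%:~R - ln u| `^ nu + (if k == m + 1 then C else 0).
  have [->|km1] := eqVneq k (m + 1).
    rewrite -[X in X <= _]add0r lerD// ?mulr_ge0 ?powR_ge0//; apply: chiC.
    rewrite -(lnK u0) -expRD -expRN !ler_expR intrD1.
    by apply/andP; split; lra.
  rewrite addr0; have [km|km] := eqVneq k m.
    rewrite km chi0 ?normr0 ?mul0r//.
    rewrite -{1 2}(lnK u0) -expRD -{1}expR0 ler_expR ltr_expR.
    by apply/andP; split; lra.
  have far : 1 <= `|k%:~R - ln u|.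
    have [k_m|m_k] := ltP k m.
      have : (k%:~R : R) + 1 <= m%:~R by rewrite -intrD1 ler_int; lia.
      by move=> ?; rewrite ler0_norm; lra.
    have : (m%:~R : R) + 1 + 1 <= k%:~R by rewrite -!intrD1 ler_int; lia.
    by move=> ?; rewrite ger0_norm; lra.
  rewrite ler_peMr//.
  have := @ge0_ler_powR _ nu (ltW nu0) 1 `|k%:~R - ln u|.
  by rewrite powR1; apply; rewrite ?nnegrE.
apply: le_trans (ler_sum (index_enum 'I_N) (fun n _ => le_term (sg n))) _.
rewrite big_split/= lerD ?momM//.
rewrite -big_mkcond/=.
(* [sg] takes the value [m + 1] at most once, so [C] is paid at most once. *)
have [/existsP[i /eqP ei]|/existsPn none] := boolP [exists i : 'I_N, sg i == m + 1].
  rewrite (bigD1 i) ?ei ?eqxx//= big1 ?addr0// => j /andP[/eqP ej /eqP].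
  by case; apply/val_inj/inj_sg; rewrite ej ei.
by rewrite big_pred0// => j; exact/negbTE.
Qed.

(** * Periodicity of the one-sided sums *)

Section PsiPeriodicity.
Variables (R : realType) (chi : R -> R).
Hypotheses (chiK : is_kernel chi) (chi0 : forall u, 1 <= u < expR 1 -> chi u = 0).

Lemma cvg_psi (p : int -> bool) (u : R) : 0 < u ->
  cvg_zsum (fun k => if p k then chi (u * expR (- k%:~R)) else 0).
Proof.
move=> u0; have [A [A0 sumA]] := kernel_sum chiK chi0.
apply: (proj1 (@zsum_bounded R _ A _)) => sg inj_sg N.
apply: le_trans (sumA _ u0 _ inj_sg N).
by apply: ler_sum => n _; case: ifP => _; rewrite ?normr0// mulrC.
Qed.

(** If [ln u] is an integer, that index belongs to neither sum; its term is [chi 1], which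
    vanishes. *)
Lemma psi_sum1 u : 0 < u -> psi_minus chi u + psi_plus chi u = 1.
Proof.
move=> u0; case: (chiK) => _ _ /(_ u (proj2 (Rpos_gt0 u) u0))[_ <-] _.
have [_ <-] := cvg_zsumD (cvg_psi (fun k => ln u < k%:~R) u0)
                         (cvg_psi (fun k => k%:~R < ln u) u0).
congr zsum; apply/funext => k; rewrite [in RHS]mulrC.
case: ltgtP => [||kL]; rewrite ?addr0 ?add0r//.
rewrite -kL -[X in X * _](lnK u0) -expRD kL subrr expR0 chi0//.
by rewrite lexx expR_gt1 ltr01.
Qed.

(** The factor [expR m%:R] translates [ln u] by [m], which the renumbering [k -> k + m] undoes. *)
Lemma psi_minus_shift (u : R) (m : nat) : 0 < u ->
  psi_minus chi (u * expR m%:R) = psi_minus chi u.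
Proof.
move=> u0; rewrite /psi_minus; have ue0 : 0 < u * expR m%:R by rewrite mulr_gt0 ?expR_gt0.
have [_ <-] := cvg_zsum_shift m (cvg_psi (fun k => ln (u * expR m%:R) < k%:~R) ue0).
congr zsum; apply/funext => k; rewrite lnM ?posrE ?expR_gt0// expRK.
rewrite rmorphD/= ltrD2r -mulrA -expRD; congr (if _ then chi (_ * expR _) else _).
by rewrite -pmulrn; ring.
Qed.

Lemma psi_minus_constant (alpha : R) :
  (forall u, 1 <= u < expR 1 -> psi_minus chi u = alpha) ->
  forall u, 0 < u -> psi_minus chi u = alpha.
Proof.
move=> psi_alpha u u0; set m := Num.floor (ln u).
have mu : (m%:~R : R) <= ln u by exact: floor_le.
have um : ln u < (m%:~R : R) + 1 by rewrite -intrD1 floorD1_gt.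
have v1e : 1 <= u * expR (- m%:~R) < expR 1.
  rewrite -{1 2}(lnK u0) -expRD -{1}expR0 ler_expR ltr_expR.
  by apply/andP; split; lra.
rewrite -(psi_alpha _ v1e).
have v0 : 0 < u * expR (- m%:~R) by rewrite mulr_gt0 ?expR_gt0.
(* A factor [e^n] with [n] natural leads from the representative in [[1, e)] to [u] when [m >= 0],
   and from [u] to the representative when [m < 0]. *)
move: (m) v0 => -[] n v0.
  rewrite -(psi_minus_shift n v0) -mulrA -expRD; congr psi_minus.
  by rewrite -pmulrn addNr expR0 mulr1.
rewrite -(psi_minus_shift n.+1 u0); congr psi_minus.
by rewrite NegzE mulrNz opprK.
Qed.

End PsiPeriodicity.

(** * Asymptotics of the Kantorovich series *)

Section KantorovichAsymptotics.
Variables (R : realType) (f : R -> R) (t Fp Fm : R).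
Hypotheses (f_bounded : [bounded f x | x in @Rpos R]) (t0 : 0 < t)
  (f_right : f (t + y) @[y --> 0^'+] --> Fp)
  (f_left : f (t - y) @[y --> 0^'+] --> Fm).

(** The series averages [f] composed with [expR], so the one-sided limits at [t] are carried to
    [ln t] by continuity of the exponential. *)
Lemma jump_near (e : R) : 0 < e -> exists2 delta : R, 0 < delta &
  (forall v : R, ln t < v < ln t + delta -> `|f (expR v) - Fp| <= e) /\
  (forall v : R, ln t - delta < v < ln t -> `|f (expR v) - Fm| <= e).
Proof.
move=> e0; have eT : expR (ln t) = t by rewrite lnK.
have [r /= r0 rP] : \forall y \near (0 : R)^'+, `|Fp - f (t + y)| <= e.
  by move/cvgrPdist_le : f_right; apply.
have [l /= l0 lP] : \forall y \near (0 : R)^'+, `|Fm - f (t - y)| <= e.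
  by move/cvgrPdist_le : f_left; apply.
have [d /= d0 dP] : \forall v \near ln t, `|expR (ln t) - expR v| < Num.min r l.
  have /cvgrPdist_lt : expR v @[v --> ln t] --> expR (ln t) by exact: continuous_expR.
  by apply; rewrite lt_min r0.
exists d => //; split => v /andP[tv vt].
  have tev : 0 < expR v - t by rewrite subr_gt0 -[X in X < _]eT ltr_expR.
  rewrite distrC -[X in f X](subrKC t); apply: rP => //=.
  have /dP : ball (ln t) d v by rewrite /ball/= ltr0_norm ?subr_lt0//; lra.
  by rewrite eT lt_min sub0r normrN (distrC t) => /andP[].
have tev : 0 < t - expR v by rewrite subr_gt0 -[X in _ < X]eT ltr_expR.
rewrite distrC (_ : expR v = t - (t - expR v)); last by rewrite subKr.
apply: lP => //=; have /dP : ball (ln t) d v by rewrite /ball/= gtr0_norm ?subr_gt0//; lra.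
by rewrite eT lt_min sub0r normrN => /andP[].
Qed.

Lemma Kantorovich_mean_near (c e w : R) (k : int) : 0 < w ->
  (forall v, k%:~R / w <= v < (k%:~R + 1) / w -> `|f (expR v) - c| <= e) ->
  `|w * lebint `[k%:~R / w, (k%:~R + 1) / w] (fun v => f (expR v)) - c| <= e.
Proof.
move=> w0 fc; have kw : (k%:~R : R) / w <= (k%:~R + 1) / w.
  by rewrite ler_pM2r ?invr_gt0// lerDl.
have := lebint_itv_near kw fc; set I := lebint _ _.
have -> : (k%:~R + 1) / w - k%:~R / w = w^-1 by rewrite -mulrBl addrC addKr mul1r.
rewrite -(ler_pM2r w0) -[X in _ * X](gtr0_norm w0) -normrM mulrBl.
by rewrite !divfK ?gt_eqF// mulrC.
Qed.

(** The two series are compared term by term. An index with [|k - L| < D] costs at most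
    [e1 * |x k|], since its window lies within [delta] of [ln t] on one side. For the others
    [(|k - L| / D)^nu >= 1], so their cost is at most [K / D^nu] times their share of the moment. *)
Lemma Kantorovich_psi (chi : R -> R) (e : R) : is_kernel chi ->
  (forall u, 1 <= u < expR 1 -> chi u = 0) -> 0 < e ->
  \forall w \near +oo, `|Kantorovich chi f w t -
    (Fp * psi_minus chi (t `^ w) + Fm * psi_plus chi (t `^ w))| <= e.
Proof.
move=> chiK chi0 e0.
have [nu [M [nu0 M0 momM]]] := kernel_moment chiK.
have [A [A0 sumA]] := kernel_sum chiK chi0.
have [B [B0 fB]] : exists B : R, 0 <= B /\ forall x : R, 0 < x -> `|f x| <= B.
  case: f_bounded => B [_ bndB]; exists (Num.max 0 (B + 1)).
  rewrite le_max lexx; split=> // x /Rpos_gt0 x0.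
  apply: (@le_trans _ _ (B + 1)); last by rewrite le_max lexx orbT.
  by apply: (bndB (B + 1)); [rewrite ltrDl|].
(* [K] bounds the distance from any value of [f] on the half-line to either limit. *)
pose K : R := B + `|Fp| + `|Fm|.
have K0 : 0 <= K by rewrite !addr_ge0.
have fp v : `|f (expR v) - Fp| <= K.
  have := fB _ (expR_gt0 v); have := normr_ge0 Fm; have := ler_normB (f (expR v)) Fp; rewrite /K; lra.
have fm v : `|f (expR v) - Fm| <= K.
  have := fB _ (expR_gt0 v); have := normr_ge0 Fp; have := ler_normB (f (expR v)) Fm; rewrite /K; lra.
(* This gives [e1 * A <= e / 4]; the [+ 1] covers [A = 0]. *)
pose e1 := e / (4 * (A + 1)).
have A1 : 0 < A + 1 by rewrite ltr_wpDl.
have e10 : 0 < e1 by rewrite divr_gt0// mulr_gt0.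
have [delta delta0 [fr fl]] := jump_near e10.
(* Once [D^nu >= Q], the far part [K * M / D^nu] is at most [e / 4]. *)
pose Q : R := 4 * K * M / e + 1.
have Q0 : 0 < Q by rewrite ltr_wpDl// divr_ge0 ?(ltW e0)// !mulr_ge0.
near=> w.
have w0 : 0 < w by near: w; exact: nbhs_pinfty_gt.
have wdelta : 2 / delta <= w by near: w; apply: nbhs_pinfty_ge; rewrite num_real.
have wQ : 2 / delta * Q `^ nu^-1 <= w by near: w; apply: nbhs_pinfty_ge; rewrite num_real.
pose u := t `^ w; have u0 : 0 < u by exact: powR_gt0.
pose L := ln u; have LE : L = w * ln t by rewrite /L/u ln_powR.
(* Half of [delta * w]: the window of [k] reaches up to [k + 1], and
   [D + 1 <= 2 * D = delta * w]. *)
pose D := delta * w / 2.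
have D0 : 0 < D by rewrite divr_gt0// mulr_gt0.
have D1 : 1 <= D by move: wdelta; rewrite /D ler_pdivrMr// ler_pdivlMr// mul1r mulrC.
have DQ : Q <= D `^ nu.
  rewrite -[X in X <= _](@powRr1 _ Q) ?(ltW Q0)// -(mulVf (lt0r_neq0 nu0)) powRrM.
  apply: ge0_ler_powR; rewrite ?nnegrE ?powR_ge0 ?(ltW nu0) ?(ltW D0)//.
  rewrite /D ler_pdivlMr//; move: wQ; rewrite mulrAC ler_pdivrMr//.
  by rewrite mulrC (mulrC delta).
pose x k := chi (expR (- k%:~R) * u).
pose c k := w * lebint `[k%:~R / w, (k%:~R + 1) / w] (fun v => f (expR v)).
pose bp k := if L < k%:~R then chi (u * expR (- k%:~R)) else 0.
pose bm k := if k%:~R < L then chi (u * expR (- k%:~R)) else 0.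
pose d k := x k * c k - (Fp * bp k + Fm * bm k).
have dE k : `|d k| <= e1 * `|x k| + K / D `^ nu * (`|x k| * `|k%:~R - L| `^ nu).
  have rhs0 : 0 <= K / D `^ nu * (`|x k| * `|k%:~R - L| `^ nu).
    by rewrite mulr_ge0 ?divr_ge0 ?mulr_ge0 ?powR_ge0.
  (* [G] will be [Fp] when [k > L] and [Fm] when [k + 1 <= L]. *)
  have key (G : R) : Fp * bp k + Fm * bm k = x k * G -> `|c k - G| <= K ->
      (`|k%:~R - L| < D -> `|c k - G| <= e1) ->
      `|d k| <= e1 * `|x k| + K / D `^ nu * (`|x k| * `|k%:~R - L| `^ nu).
    move=> bE cK ce1; rewrite /d bE -mulrBr normrM.
    have [/ce1 {}ce1|Dk] := ltP `|k%:~R - L| D.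
      by rewrite ler_wpDr// mulrC ler_wpM2r.
    apply: (@le_trans _ _ (K / D `^ nu * (`|x k| * `|k%:~R - L| `^ nu))); last first.
      by rewrite lerDr mulr_ge0// ltW.
    rewrite [leRHS]mulrCA ler_wpM2l// (le_trans cK)//.
    rewrite -mulrA ler_peMr// mulrC ler_pdivlMr ?powR_gt0// mul1r.
    by apply: ge0_ler_powR; rewrite ?nnegrE ?(ltW nu0) ?(ltW D0).
  have [Lk|kL] := ltP L k%:~R.
    apply: (key Fp).
    - by rewrite /bp /bm Lk ltNge (ltW Lk)/= mulr0 addr0 /x mulrC (mulrC u).
    - by apply: Kantorovich_mean_near.
    - rewrite gtr0_norm ?subr_gt0// => kLD; apply: Kantorovich_mean_near => // v.
      rewrite ler_pdivrMr// ltr_pdivlMr// => /andP[kv vk]; apply: fr.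
      by apply/andP; split; rewrite -(ltr_pM2r w0); move: kLD D1; rewrite /D; lra.
  have [k1L|Lk1] := leP (k%:~R + 1) L.
    have kL' : k%:~R < L by lra.
    apply: (key Fm).
    - by rewrite /bp /bm kL' ltNge kL/= mulr0 add0r /x mulrC (mulrC u).
    - by apply: Kantorovich_mean_near.
    - rewrite ltr0_norm ?subr_lt0// => kLD; apply: Kantorovich_mean_near => // v.
      rewrite ler_pdivrMr// ltr_pdivlMr// => /andP[kv vk]; apply: fl.
      by apply/andP; split; rewrite -(ltr_pM2r w0); move: kLD D1; rewrite /D; lra.
  (* Here [k <= L < k + 1]: the window contains [ln t], but [e^(-k) u] lies in [[1, e)], where [chi]
     vanishes. *)
  have x0 : x k = 0.
    rewrite /x chi0// -{1 2}(lnK u0) -expRD -{1}expR0 ler_expR ltr_expR -/L.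
    by apply/andP; split; lra.
  have bm0 : bm k = 0 by rewrite /bm; case: ifP => // _; rewrite mulrC.
  by rewrite /d x0 bm0 /bp ltNge kL/= mul0r !mulr0 addr0 subr0 normr0 mul0r !mulr0 addr0.
have sum_d (sg : nat -> int) : injective sg -> forall N : nat, \sum_(n < N) `|d (sg n)| <= e1 * A + K / D `^ nu * M.
  move=> inj_sg N; apply: le_trans (ler_sum (index_enum 'I_N) (fun n _ => dE (sg n))) _.
  rewrite big_split/= -!mulr_sumr lerD// ler_wpM2l ?sumA ?momM ?(ltW e10)//.
  by rewrite divr_ge0// powR_ge0.
have [cd ld] := zsum_bounded sum_d.
have [cbp ebp] := cvg_zsumZ Fp (cvg_psi chiK chi0 (fun k => L < k%:~R) u0).
have [cbm ebm] := cvg_zsumZ Fm (cvg_psi chiK chi0 (fun k => k%:~R < L) u0).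
have [cb eb] := cvg_zsumD cbp cbm.
have [_ ea] := cvg_zsumD cd cb.
have -> : Kantorovich chi f w t = zsum d + (Fp * psi_minus chi u + Fm * psi_plus chi u).
  rewrite -ebp -ebm -eb -ea; congr zsum; apply/funext => k.
  by rewrite /d subrK.
(* [zsum_bounded] doubles the bound, hence the two quarters of [e]. *)
rewrite addrK (le_trans ld)//.
have : e1 * A <= e / 4.
  by rewrite /e1 mulrAC ler_pdivrMr ?mulr_gt0//; nra.
have : K / D `^ nu * M <= e / 4.
  rewrite mulrAC ler_pdivrMr ?powR_gt0//; apply: le_trans (ler_wpM2l _ DQ); last first.
    by rewrite divr_ge0// ltW.
  rewrite /Q mulrDr mulr1; apply: (@le_trans _ _ (e / 4 * (4 * K * M / e))).
    by rewrite le_eqVlt; apply/orP; left; apply/eqP; field; rewrite gt_eqF.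
  by rewrite lerDl divr_ge0// ltW.
lra.
Unshelve. all: by end_near. Qed.

End KantorovichAsymptotics.

(** * Passage between the limit (i) and the identity (ii) *)

Section JumpAlgebra.
Variables (R : realType) (f : R -> R) (t alpha : R) (chi : R -> R).
Hypotheses (f_bounded : [bounded f x | x in @Rpos R]) (t_pos : Rpos t)
  (t_jump : jump_discontinuity f t) (chiK : is_kernel chi)
  (chi0 : forall u, 1 <= u < expR 1 -> chi u = 0).

Let Fp := right_lim f t.
Let Fm := left_lim f t.

(** Eliminating [psi_plus] through [psi_sum1] leaves an affine function of [psi_minus] with slope
    [Fp - Fm], which is nonzero at a jump. *)
Lemma Kantorovich_psi_minus (e : R) : 0 < e ->
  \forall w \near +oo,
    `|Kantorovich chi f w t - (Fm + psi_minus chi (t `^ w) * (Fp - Fm))| <= e.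
Proof.
move=> e0; have t0 := proj1 (Rpos_gt0 t) t_pos; case: t_jump => cr cl _.
have := Kantorovich_psi f_bounded t0 cr cl chiK chi0 e0; apply: filterS => w.
rewrite -/(right_lim f t) -/(left_lim f t) -/Fp -/Fm.
have -> : psi_plus chi (t `^ w) = 1 - psi_minus chi (t `^ w).
  by rewrite -(psi_sum1 chiK chi0 (powR_gt0 w t0)) addrAC subrr add0r.
by congr (`|_ - _| <= _); ring.
Qed.

Lemma psi_minus_Kantorovich :
  (forall u, 1 <= u < expR 1 -> psi_minus chi u = alpha) ->
  Kantorovich chi f w t @[w --> +oo] --> alpha * Fp + (1 - alpha) * Fm.
Proof.
move=> psi_alpha; apply/cvgrPdist_le => e e0.
have := Kantorovich_psi_minus e0; apply: filterS => w.
rewrite (psi_minus_constant chiK chi0 psi_alpha) ?powR_gt0//; last exact/Rpos_gt0.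
by rewrite distrC; congr (`|_ - _| <= _); ring.
Qed.

(* When [t <> 1] the points [t^w] visit every class [u e^Z] for arbitrarily
   large [w]. *)
Lemma Kantorovich_psi_minus_limit : t <> 1 ->
  Kantorovich chi f w t @[w --> +oo] --> alpha * Fp + (1 - alpha) * Fm ->
  forall u, 1 <= u < expR 1 -> psi_minus chi u = alpha.
Proof.
move=> t1 /cvgrPdist_le cvgI u /andP[u1 _].
have t0 := proj1 (Rpos_gt0 t) t_pos.
have u0 : 0 < u by rewrite (lt_le_trans ltr01).
have lnt0 : ln t != 0 by apply/eqP => /eqP; rewrite ln_eq0// => /eqP.
(* The equation [w * ln t = ln u + n], or [ln u - n] when [ln t < 0], makes [t^w] and [u] differ by
   an integer power of [e]; a large [n] pushes [w] beyond [W]. *)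
have visits (W : R) : exists w, W < w /\ psi_minus chi (t `^ w) = psi_minus chi u.
  pose n := Num.bound (`|ln u| + `|W| * `|ln t|).
  have nbig : `|ln u| + `|W| * `|ln t| < n%:R by rewrite archi_boundP// addr_ge0// mulr_ge0.
  have [lnt_gt0|] := ltP 0 (ln t).
    exists ((ln u + n%:R) / ln t); split.
      rewrite ltr_pdivlMr//; move: nbig; rewrite (gtr0_norm lnt_gt0).
      have := ler_norm W; have := ler_norm (- ln u); rewrite normrN; nra.
    rewrite -(psi_minus_shift chiK chi0 n u0); congr psi_minus.
    by rewrite /powR gt_eqF// divfK// expRD lnK.
  rewrite le_eqVlt (negbTE lnt0)/= => lnt_lt0.
  exists ((ln u - n%:R) / ln t); split.
    rewrite ltr_ndivlMr//; move: nbig; rewrite (ltr0_norm lnt_lt0).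
    have := ler_norm W; have := ler_norm (ln u); nra.
  rewrite -(psi_minus_shift chiK chi0 n (powR_gt0 _ t0)); congr psi_minus.
  by rewrite /powR gt_eqF// divfK// -expRD subrK lnK.
case: t_jump => _ _ /eqP; rewrite -subr_eq0 -/Fp -/Fm => dF0.
apply/eqP; rewrite -subr_eq0; apply/negP => /negP psi_alpha.
(* At a visiting [w] the series would be within [|x| / 4] of two numbers at distance [|x|]. *)
pose x := (psi_minus chi u - alpha) * (Fp - Fm).
have x0 : 0 < `|x| by rewrite normr_gt0 mulf_neq0.
have e0 : 0 < `|x| / 4 by rewrite divr_gt0.
have /= [W [_ WP]] := filterI (cvgI _ e0) (Kantorovich_psi_minus e0).
have [w [Ww psi_w]] := visits W; have [] := WP w Ww; rewrite psi_w.
set I := Kantorovich _ _ _ _ => d1 d2.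
have : `|x| <= `|alpha * Fp + (1 - alpha) * Fm - I| +
    `|I - (Fm + psi_minus chi u * (Fp - Fm))|.
  by rewrite -normrN; apply: le_trans (ler_normD _ _); rewrite le_eqVlt; apply/orP; left; apply/eqP; congr (`|_|); rewrite /x; ring.
lra.
Qed.
End JumpAlgebra.

(** * Uniqueness of Fourier coefficients *)

Section FourierUniqueness.
Variable R : realType.
Local Notation mu := (@lebesgue_measure R).
Local Notation int01 f := (\int[mu]_(x in `[0 : R, 1]) f x).

Lemma continuous_within_itv (g : R -> R) (a b : R) :
  continuous g -> {within `[a, b], continuous g}.
Proof. by move=> cg; apply: continuous_subspaceT. Qed.

Lemma continuous_integrable_itv (g : R -> R) (a b : R) : continuous g ->
  mu.-integrable `[a, b] (EFin \o g).
Proof.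
move=> cg; apply: continuous_compact_integrable; first exact: segment_compact.
exact: continuous_within_itv.
Qed.

Lemma continuousM_fun (g h : R -> R) :
  continuous g -> continuous h -> continuous (fun x => g x * h x).
Proof. by move=> cg ch x; apply: cvgM; [exact: cg|exact: ch]. Qed.

Lemma continuousD_fun (g h : R -> R) :
  continuous g -> continuous h -> continuous (fun x => g x + h x).
Proof. by move=> cg ch x; apply: cvgD; [exact: cg|exact: ch]. Qed.

Lemma continuous_scale (w : R) : continuous (fun s : R => w * s).
Proof. by move=> s; apply: cvgM; [exact: cvg_cst|exact: cvg_id]. Qed.

Lemma continuous_cos_scale (w : R) : continuous (fun s : R => cos (w * s)).
Proof.
move=> s; apply: (@continuous_comp _ _ _ (fun s => w * s) cos).
  exact: continuous_scale.
exact: continuous_cos.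
Qed.

Lemma continuous_sin_scale (w : R) : continuous (fun s : R => sin (w * s)).
Proof.
move=> s; apply: (@continuous_comp _ _ _ (fun s => w * s) sin).
  exact: continuous_scale.
exact: continuous_sin.
Qed.

Lemma continuous_cos_affine (a b : R) :
  continuous (fun s : R => cos (a * s + b)).
Proof.
move=> s; apply: (@continuous_comp _ _ _ (fun s => a * s + b) cos).
  by apply: cvgD; [exact: continuous_scale|exact: cvg_cst].
exact: continuous_cos.
Qed.

Let freq (k : int) : R := 2 * k%:~R * pi.

Lemma cos_ge_near (d x : R) : 0 <= d <= 2^-1 -> `|x| <= d ->
  cos (2 * pi * d) <= cos (2 * pi * x).
Proof.
move=> /andP[d0 d2] xd; have pi0 : 0 < pi :> R by exact: pi_gt0.
have -> : cos (2 * pi * x) = cos (2 * pi * `|x|).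
  by case: (ger0P x) => // _; rewrite mulrN cosN.
have := normr_ge0 x; move: xd; set y := `|x| => yd y0.
rewrite leNgt ltr_cos ?in_itv/=; [|by apply/andP; split; nra|by apply/andP; split; nra].
by rewrite -leNgt ler_pM2l// mulr_gt0.
Qed.

(** Beyond the half period, the symmetry [y -> 1 - y] of [cos (2 * pi * y)] brings the point back to
    [[d, 1/2]], where this function decreases. *)
Lemma cos_le_far (d x : R) : 0 <= d <= 2^-1 -> d <= `|x| <= 1 - d ->
  cos (2 * pi * x) <= cos (2 * pi * d).
Proof.
move=> /andP[d0 d2] xd; have pi0 : 0 < pi :> R by exact: pi_gt0.
have -> : cos (2 * pi * x) = cos (2 * pi * `|x|).
  by case: (ger0P x) => // _; rewrite mulrN cosN.
move: xd; set y := `|x| => /andP[dy yd].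
have decr z : d <= z <= 2^-1 -> cos (2 * pi * z) <= cos (2 * pi * d).
  by move=> /andP[dz z2]; apply: cos_ge_near; [apply/andP; split; lra|rewrite ger0_norm].
have [y2|y2] := leP y 2^-1; first by apply: decr; rewrite dy.
have -> : cos (2 * pi * y) = cos (2 * pi * (1 - y)).
  by rewrite -[LHS]cosN -[LHS]cosD2pi; congr cos; rewrite -mulr_natl; ring.
by apply: decr; apply/andP; split; lra.
Qed.

Lemma cosMcos (x y : R) : cos x * cos y = 2^-1 * cos (y + x) + 2^-1 * cos (y - x).
Proof. by rewrite !cosD cosN sinN; field. Qed.

Variable h : R -> R.
Hypothesis ch : continuous h.

(** By the product formula, the new cosine factor only produces the frequencies [k + 1] and [k - 1].
    The free phase [q] treats cosines and sines at once. *)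
Lemma trig_orthogonal_step (C p : R) (T : R -> R) : continuous T ->
  (forall (k : int) q, int01 (fun s => h s * T s * cos (freq k * s + q)) = 0) ->
  forall (k : int) q,
    int01 (fun s => h s * (T s * (C + cos (freq 1 * s + p))) * cos (freq k * s + q)) = 0.
Proof.
move=> cT T0 k q.
have cc (j : int) r : continuous (fun s => h s * T s * cos (freq j * s + r)).
  by apply: continuousM_fun; [exact: continuousM_fun|exact: continuous_cos_affine].
have ci (c : R) (j : int) r :
    mu.-integrable `[0, 1] (EFin \o (fun s => c * (h s * T s * cos (freq j * s + r)))).
  apply: continuous_integrable_itv; apply: continuousM_fun => //; exact: cst_continuous.
have cZ (c : R) (j : int) r :
    int01 (fun s => c * (h s * T s * cos (freq j * s + r))) = 0.
  by rewrite RintegralZl// ?T0 ?mulr0//; exact: continuous_integrable_itv.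
transitivity (int01 (fun s => C * (h s * T s * cos (freq k * s + q)) +
  (2^-1 * (h s * T s * cos (freq (k + 1) * s + (q + p))) +
   2^-1 * (h s * T s * cos (freq (k - 1) * s + (q - p)))))).
  apply: eq_Rintegral => s _.
  have := cosMcos (freq 1 * s + p) (freq k * s + q).
  have -> : freq k * s + q + (freq 1 * s + p) = freq (k + 1) * s + (q + p).
    by rewrite /freq rmorphD/=; ring.
  have -> : freq k * s + q - (freq 1 * s + p) = freq (k - 1) * s + (q - p).
    by rewrite /freq rmorphB/=; ring.
  set c1 := cos _; set c2 := cos _ => E.
  transitivity (C * (h s * T s * c2) + h s * T s * (c1 * c2)); first by ring.
  by rewrite E; ring.
have iD : mu.-integrable `[0, 1] (EFin \o (fun s =>
    2^-1 * (h s * T s * cos (freq (k + 1) * s + (q + p))) +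
    2^-1 * (h s * T s * cos (freq (k - 1) * s + (q - p))))).
  apply: continuous_integrable_itv; apply: continuousD_fun;
    apply: continuousM_fun => //; exact: cst_continuous.
by rewrite RintegralD// cZ RintegralD// !cZ !addr0.
Qed.

Hypothesis h_cos : forall k : int, int01 (fun s => h s * cos (freq k * s)) = 0.
Hypothesis h_sin : forall k : int, int01 (fun s => h s * sin (freq k * s)) = 0.

(** Induction on [n] by the previous step; for [n = 0] the addition formula reduces a phase-shifted
    cosine to [h_cos] and [h_sin]. *)
Lemma trig_pow_orthogonal (C p : R) (n : nat) (k : int) (q : R) :
  int01 (fun s => h s * (C + cos (freq 1 * s + p)) ^+ n * cos (freq k * s + q)) = 0.
Proof.
elim: n k q => [|n IHn] k q.
  have cc : continuous (fun s => h s * cos (freq k * s)).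
    by apply: continuousM_fun => //; exact: continuous_cos_scale.
  have cs : continuous (fun s => h s * sin (freq k * s)).
    by apply: continuousM_fun => //; exact: continuous_sin_scale.
  transitivity (int01 (fun s => cos q * (h s * cos (freq k * s)) +
     - sin q * (h s * sin (freq k * s)))).
    by apply: eq_Rintegral => s _; rewrite expr0 cosD; ring.
  rewrite RintegralD//; last 2 first.
  - by apply: continuous_integrable_itv; apply: continuousM_fun => //; exact: cst_continuous.
  - by apply: continuous_integrable_itv; apply: continuousM_fun => //; exact: cst_continuous.
  rewrite !RintegralZl//; last 2 first.
  - exact: continuous_integrable_itv.
  - exact: continuous_integrable_itv.
  by rewrite h_cos h_sin !mulr0 addr0.
rewrite -[RHS](@trig_orthogonal_step C p (fun s => (C + cos (freq 1 * s + p)) ^+ n) _ IHn k q).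
  by apply: eq_Rintegral => s _; rewrite exprSr.
move=> s; apply: (@continuous_comp _ _ _ (fun s => C + cos (freq 1 * s + p)) (fun x => x ^+ n)).
  by apply: cvgD; [exact: cvg_cst|exact: continuous_cos_affine].
exact: exprn_continuous.
Qed.

(** This step function will be placed below [h * T^n] in the positivity argument. *)
Lemma int01_bump (a b c B : R) : 0 <= a -> a <= b -> b <= 1 ->
  mu.-integrable `[0, 1] (EFin \o (fun s => c * \1_`[a, b] s - B)) /\
  int01 (fun s => c * \1_`[a, b] s - B) = c * (b - a) - B.
Proof.
move=> a0 ab b1.
have i1 : mu.-integrable `[0, 1] (EFin \o (\1_`[a, b] : R -> R)).
  apply: (@integrableS _ _ _ mu setT) => //; exact: integrable_indic_itv.
have ic : mu.-integrable `[0, 1] (EFin \o (fun s => c * \1_`[a, b] s)).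
  exact: (integrableZl _ c i1).
have iB : mu.-integrable `[0, 1] (EFin \o (fun=> B)).
  by apply: continuous_integrable_itv; exact: cst_continuous.
split; first exact: (integrableB _ ic iB).
rewrite RintegralB// RintegralZl// Rintegral_cst//; congr (_ * _ - _).
  rewrite /Rintegral integral_indic// setIidl; last first.
    move=> x /=; rewrite !in_itv/= => /andP[ax xb].
    by rewrite (le_trans a0)// (le_trans xb).
  have := lebesgue_measure_itv `[a, b]; rewrite /= => ->; rewrite lte_fin; case: ltgtP ab => //= -> _.
  by rewrite subrr.
by have := lebesgue_measure_itv `[0 : R, 1]; rewrite /= => ->; rewrite lte_fin ltr01/= subr0 mulr1.
Qed.

Lemma ler_Bernoulli (c : R) n : 0 <= c -> n%:R * c <= (1 + c) ^+ n.
Proof.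
move=> c0; suff : 1 + n%:R * c <= (1 + c) ^+ n.
  by apply: le_trans; rewrite lerDr.
elim: n => [|n IHn]; first by rewrite mul0r addr0 expr0.
rewrite exprSr -natr1 (le_trans _ (ler_wpM2r _ IHn)) ?addr_ge0//.
have n0 : 0 <= n%:R :> R by [].
by nra.
Qed.

(* The trigonometric polynomial [T = 1 + cos (2 pi (s - s0)) - cos (2 pi d)] is
   bounded by 1 away from [s0] and exceeds [1 + c] near [s0], so that
   the integral of [h T^n], which must vanish, tends to infinity. *)
Lemma fourier_pos_contra (s0 : R) : 0 < s0 < 1 -> 0 < h s0 -> False.
Proof.
move=> /andP[s00 s01] hs0.
(* [d <= s0] and [d <= 1 - s0] keep the window around [s0] inside [[0, 1]]; [d <= 1/2] keeps
   [2 * pi * d] in [[0, pi]], where the cosine decreases. *)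
have [d [d0 d2 ds0 ds1 hd]] : exists d : R, [/\ 0 < d, d <= 2^-1, d <= s0, d <= 1 - s0 &
    forall s, `|s - s0| < d -> h s0 / 2 <= h s].
  have [e /= e0 eP] : \forall s \near s0, `|h s0 - h s| <= h s0 / 2.
    by have /cvgrPdist_le := @ch s0; apply; rewrite divr_gt0.
  exists (Num.min e (Num.min 2^-1 (Num.min s0 (1 - s0)))); split.
  - by rewrite !lt_min e0 invr_gt0 ltr0n s00 subr_gt0.
  - by rewrite !ge_min lexx orbT.
  - by rewrite !ge_min lexx !orbT.
  - by rewrite !ge_min lexx !orbT.
  - move=> s; rewrite lt_min => /andP[se _].
    have : `|h s0 - h s| <= h s0 / 2 by apply: eP; rewrite /ball/= distrC.
    by rewrite ler_norml => /andP[_]; lra.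
have [B [B0 hB]] : exists B : R, 0 <= B /\ forall s, 0 <= s <= 1 -> `|h s| <= B.
  have : bounded_set [set h s | s in `[0 : R, 1]].
    apply: compact_bounded; apply: continuous_compact; last exact: segment_compact.
    exact: continuous_within_itv.
  move=> [B [_ bndB]]; exists (Num.max 0 (B + 1)); rewrite le_max lexx; split=> // s s01'.
  apply: (@le_trans _ _ (B + 1)); last by rewrite le_max lexx orbT.
  by apply: (bndB (B + 1)); [rewrite ltrDl|exists s => //; rewrite /= in_itv].
pose C := 1 - cos (2 * pi * d).
pose T s := C + cos (freq 1 * s + - (freq 1 * s0)).
have TE s : T s = 1 + (cos (2 * pi * (s - s0)) - cos (2 * pi * d)).
  rewrite /T /C /freq rmorph1 mulr1 -mulrBr; ring.
(* [c] is the guaranteed excess of [T] over 1 on the half window [|s - s0| <= d / 2]. *)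
pose c := cos (2 * pi * (d / 2)) - cos (2 * pi * d).
have c0 : 0 < c.
  have pi0 : 0 < pi :> R by exact: pi_gt0.
  by rewrite subr_gt0 ltr_cos ?in_itv/= ?ltr_pM2l ?mulr_gt0//; [|apply/andP; split|apply/andP; split]; nra.
have T_ge1 s : `|s - s0| <= d -> 1 <= T s.
  by move=> sd; rewrite TE lerDl subr_ge0 cos_ge_near// (ltW d0).
have T_near s : `|s - s0| <= d / 2 -> 1 + c <= T s.
  move=> sd; rewrite TE lerD2l lerD2r cos_ge_near//; apply/andP; split; lra.
have T_far s : 0 <= s <= 1 -> d <= `|s - s0| -> `|T s| <= 1.
  move=> /andP[s_ge0 s_le1] ds; rewrite TE ler_norml.
  have : cos (2 * pi * (s - s0)) <= cos (2 * pi * d).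
    rewrite cos_le_far ?(ltW d0)// ds/=.
    by have [?|?] := leP s0 s; [rewrite ger0_norm|rewrite ltr0_norm]; lra.
  have := cos_geN1 (2 * pi * (s - s0)); have := cos_le1 (2 * pi * d).
  by move=> ? ? ?; apply/andP; split; lra.
(* The integrand is at least [h s0 / 2 * (1 + c)^n] on the half window, nonnegative on the rest of
   the window and at least [- B] elsewhere, while its integral is 0. *)
have low n : h s0 / 2 * (1 + c) ^+ n * d <= B.
  have cT : continuous (fun s => h s * T s ^+ n).
    apply: continuousM_fun => // s.
    apply: (@continuous_comp _ _ _ T (fun x => x ^+ n)); last exact: exprn_continuous.
    by apply: cvgD; [exact: cvg_cst|exact: continuous_cos_affine].
  have I0 : int01 (fun s => h s * T s ^+ n) = 0.
    rewrite -[RHS](trig_pow_orthogonal C (- (freq 1 * s0)) n 0 0).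
    by apply: eq_Rintegral => s _; rewrite /freq mulr0 mul0r mul0r addr0 cos0 mulr1.
  have := @int01_bump (s0 - d / 2) (s0 + d / 2) (h s0 / 2 * (1 + c) ^+ n) B.
  have -> : s0 + d / 2 - (s0 - d / 2) = d by field.
  case; [lra|lra|lra|move=> ib eb].
  rewrite -subr_le0 -eb -[leRHS]I0; apply: le_Rintegral => //.
  - exact: continuous_integrable_itv.
  - move=> s /=; rewrite in_itv/= indicE mem_setE in_itv/= => s01'.
    have hs0' : 0 <= h s0 / 2 by rewrite divr_ge0// ltW.
    have hB' : - B <= h s by have := hB _ s01'; rewrite ler_norml => /andP[].
    have [sd|sd] := boolP (s0 - d / 2 <= s <= s0 + d / 2).
      have sd2 : `|s - s0| <= d / 2 by rewrite ler_distl.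
      rewrite mulr1 ler_wnDr ?oppr_le0//; apply: ler_pM => //.
      + by rewrite exprn_ge0// addr_ge0// ltW.
      + by apply: hd; lra.
      + by have := T_near s sd2 => Ts; rewrite lerXn2r ?nnegrE//; lra.
    rewrite mulr0 sub0r; have [sd'|sd'] := ltP `|s - s0| d.
      rewrite (@le_trans _ _ 0) ?oppr_le0// mulr_ge0//.
        by rewrite (le_trans hs0')// hd.
      by rewrite exprn_ge0// (le_trans ler01)// T_ge1// ltW.
    have : `|h s * T s ^+ n| <= B.
      rewrite normrM -[leRHS]mulr1 ler_pM ?hB// normrX exprn_ile1// ?T_far//.
    by rewrite ler_norml => /andP[].
(* For this [n], Bernoulli's inequality lifts the left side of [low] above [B]. *)
pose n := Num.bound (B / (h s0 / 2 * c * d)).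
have k0 : 0 < h s0 / 2 * c * d by rewrite !mulr_gt0 ?invr_gt0.
have nbig : B < n%:R * (h s0 / 2 * c * d).
  by rewrite -ltr_pdivrMr// archi_boundP// divr_ge0// ltW.
have := low n; apply/negP; rewrite -ltNge (lt_le_trans nbig)//.
rewrite (_ : _ * (_ * _ * _) = h s0 / 2 * d * (n%:R * c)); last by ring.
rewrite (_ : _ * (1 + c) ^+ n * d = h s0 / 2 * d * (1 + c) ^+ n); last by ring.
by rewrite ler_wpM2l ?ler_Bernoulli ?(ltW c0)// mulr_ge0 ?divr_ge0// ltW.
Qed.

End FourierUniqueness.

(** On [(0, 1)] the positivity argument applies to both [h] and [- h]; the value at 0 follows by
    continuity. *)
Lemma fourier_uniqueness (R : realType) (h : R -> R) : continuous h ->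
  (forall k : int, \int[lebesgue_measure]_(s in `[0, 1]) (h s * cos (2 * k%:~R * pi * s)) = 0) ->
  (forall k : int, \int[lebesgue_measure]_(s in `[0, 1]) (h s * sin (2 * k%:~R * pi * s)) = 0) ->
  forall s, 0 <= s < 1 -> h s = 0.
Proof.
move=> ch hc hs.
have inner s : 0 < s < 1 -> h s = 0.
  move=> s01; have [hs0|hs0|//] := ltgtP (h s) 0; exfalso; last first.
    exact: (fourier_pos_contra ch hc hs s01).
  apply: (@fourier_pos_contra R (fun x => - h x) _ _ _ s s01); last by rewrite oppr_gt0.
  - by move=> x; apply: cvgN; exact: ch.
  - move=> k; rewrite -[RHS]oppr0 -[in RHS](hc k) -mulN1r -RintegralZl//.
      by apply: eq_Rintegral => x _; rewrite mulN1r mulNr.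
    apply: continuous_integrable_itv; apply: continuousM_fun => //.
    exact: continuous_cos_scale.
  - move=> k; rewrite -[RHS]oppr0 -[in RHS](hs k) -mulN1r -RintegralZl//.
      by apply: eq_Rintegral => x _; rewrite mulN1r mulNr.
    apply: continuous_integrable_itv; apply: continuousM_fun => //.
    exact: continuous_sin_scale.
move=> s /andP[]; rewrite le_eqVlt => /orP[/eqP <- _|s0 s1]; last by rewrite inner ?s0.
apply/eqP; apply/negP => /negP h0.
have [e /= e0 eP] : \forall s \near (0 : R), h s != 0.
  have /cvgrPdist_lt/(_ `|h 0|) := @ch 0; rewrite normr_gt0 => /(_ h0).
  by apply: filterS => x; apply: contraTneq => ->; rewrite subr0 ltxx.
have m0 : 0 < Num.min e 1 / 2 by rewrite divr_gt0// lt_min e0 ltr01.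
have : h (Num.min e 1 / 2) != 0.
  apply: eP; rewrite /ball/= sub0r normrN gtr0_norm//.
  by rewrite ltr_pdivrMr// gt_min; apply/orP; left; lra.
rewrite inner ?eqxx// m0/= ltr_pdivrMr// gt_min; apply/orP; right; lra.
Qed.

(** * Fourier coefficients of a constant *)

Section TrigonometricMoments.
Variable R : realType.
Local Notation mu := (@lebesgue_measure R).

Lemma cos_sin_2pi_int (x : R) (m : int) :
  cos (x + 2 * m%:~R * pi) = cos x /\ sin (x + 2 * m%:~R * pi) = sin x.
Proof.
have nat_per (y : R) n : cos (y + 2 * n%:R * pi) = cos y /\ sin (y + 2 * n%:R * pi) = sin y.
  have -> : 2 * n%:R * pi = (pi *+ 2) *+ n :> R by rewrite -(mulr_natl (pi *+ 2)) -(mulr_natl pi); ring.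
  by rewrite (periodicn (@cosD2pi R)) (periodicn (@sinD2pi R)).
case: m => n; first by rewrite -pmulrn; exact: nat_per.
(* For negative [m], the natural case at the translated point leads back to [x]. *)
have [<- <-] := nat_per (x + 2 * (Negz n)%:~R * pi) n.+1.
by rewrite NegzE mulrNz -pmulrn mulrN mulNr subrK.
Qed.

Lemma integral_derive (F f : R -> R) : continuous f ->
  (forall x : R, is_derive x 1 F (f x)) -> \int[mu]_(s in `[0, 1]) f s = F 1 - F 0.
Proof.
move=> cf dF; have cF : continuous F.
  move=> x; apply: differentiable_continuous; apply/derivable1_diffP.
  by have [] := dF x.
rewrite /Rintegral (@continuous_FTC2 R f F 0 1) ?ltr01//.
- exact: continuous_within_itv.
- split.
  + by move=> x _; have [] := dF x.
  + by apply: cvg_at_right_filter; exact: cF.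
  + by apply: cvg_at_left_filter; exact: cF.
- by move=> x _; rewrite derive1E; have [_ ->] := dF x.
Qed.

Lemma is_derive_scale (c : R) (F : R -> R) (x d : R) : is_derive x 1 F d ->
  is_derive x 1 (fun s => c * F s) (c * d).
Proof. by move=> dF; exact: (is_deriveZ c dF). Qed.

Lemma integral_cos_sin (k : int) :
  \int[mu]_(s in `[0, 1]) cos (2 * k%:~R * pi * s) = (k == 0)%:R /\
  \int[mu]_(s in `[0, 1]) sin (2 * k%:~R * pi * s) = 0.
Proof.
have [->|k0] := eqVneq k 0.
  split.
    rewrite (@eq_Rintegral _ _ _ mu `[0 : R, 1] (fun=> 1)) => [|s _]; last by rewrite mulr0 !mul0r cos0.
    by apply: etrans (@integral_derive id _ _ _) (subr0 _); exact: cst_continuous.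
  rewrite (@eq_Rintegral _ _ _ mu `[0 : R, 1] (fun=> 0)) => [|s _]; last by rewrite mulr0 !mul0r sin0.
  by apply: etrans (@integral_derive (fun=> 0) _ _ _) (subr0 _); exact: cst_continuous.
set w := 2 * k%:~R * pi.
have w0 : w != 0 by rewrite !mulf_neq0 ?intr_eq0 ?pnatr_eq0// gt_eqF// pi_gt0.
have [cw sw] := cos_sin_2pi_int 0 k; rewrite add0r cos0 sin0 -/w in cw sw.
have dl (x : R) : is_derive x 1 (fun s : R => w * s) w.
  by rewrite -[X in is_derive _ _ _ X]mulr1; apply: is_derive_scale; exact: is_derive_id.
split.
  apply: etrans (@integral_derive (fun s => w^-1 * sin (w * s)) _ _ _) _.
  - exact: continuous_cos_scale.
  - move=> x; have := is_derive1_comp (is_derive_sin (w * x)) (dl x).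
    by move=> /(is_derive_scale w^-1); rewrite mulrCA mulVf// mulr1.
  - by rewrite mulr1 mulr0 sw sin0 subrr.
apply: etrans (@integral_derive (fun s => - w^-1 * cos (w * s)) _ _ _) _.
- exact: continuous_sin_scale.
- move=> x; have := is_derive1_comp (is_derive_cos (w * x)) (dl x).
  by move=> /(is_derive_scale (- w^-1)); rewrite mulrCA !mulNr mulVf// mulrN1 opprK.
- by rewrite mulr1 mulr0 cw cos0 subrr.
Qed.

(** Uniqueness is applied to [g = h - a]: the constant [a] contributes only to the cosine
    coefficient with [k = 0]. *)
Lemma fourier_constantP (h : R -> R) (a : R) : continuous h ->
  (forall s, 0 <= s < 1 -> h s = a) <->
  (forall k : int, \int[mu]_(s in `[0, 1]) (h s * cos (2 * k%:~R * pi * s)) = a * (k == 0)%:R /\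
    \int[mu]_(s in `[0, 1]) (h s * sin (2 * k%:~R * pi * s)) = 0).
Proof.
move=> ch; pose g s := h s - a.
have cg : continuous g by move=> x; apply: cvgB; [exact: ch|exact: cvg_cst].
have split_int (T : R -> R) : continuous T -> \int[mu]_(s in `[0, 1]) (h s * T s) =
    \int[mu]_(s in `[0, 1]) (g s * T s) + a * \int[mu]_(s in `[0, 1]) T s.
  move=> cT; rewrite -RintegralZl//; last exact: continuous_integrable_itv.
  rewrite -RintegralD//; last 2 first.
  - by apply: continuous_integrable_itv; exact: continuousM_fun.
  - by apply: continuous_integrable_itv; apply: continuousM_fun => //; exact: cst_continuous.
  by apply: eq_Rintegral => s _; rewrite -mulrDl subrK.
have coefE k : 
   \int[mu]_(s in `[0, 1]) (h s * cos (2 * k%:~R * pi * s)) =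
   \int[mu]_(s in `[0, 1]) (g s * cos (2 * k%:~R * pi * s)) + a * (k == 0)%:R /\
   \int[mu]_(s in `[0, 1]) (h s * sin (2 * k%:~R * pi * s)) =
   \int[mu]_(s in `[0, 1]) (g s * sin (2 * k%:~R * pi * s)).
  have [Ic Is] := integral_cos_sin k.
  rewrite (split_int _ (@continuous_cos_scale _ _)) (split_int _ (@continuous_sin_scale _ _)).
  by rewrite Ic Is mulr0 addr0.
split => [ha k|coef s s01].
  have g0 (T : R -> R) : continuous T -> \int[mu]_(s in `[0, 1]) (g s * T s) = 0.
    (* [h = a] is known on [[0, 1)] only; the endpoint 1 is negligible. *)
    move=> cT; rewrite -(@Rintegral_itv_bndo_bndc R (BLeft 0) 1); last first.
      apply: (@integrableS _ _ _ mu `[0, 1]) => //.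
        by move=> s /=; rewrite !in_itv/= => /andP[-> /ltW].
      by apply: continuous_integrable_itv; exact: continuousM_fun.
    rewrite (@eq_Rintegral _ _ _ mu `[0 : R, 1[ (fun=> 0)); first by rewrite /Rintegral integral0.
    by move=> s; rewrite inE/= in_itv/= => /ha hs; rewrite /g hs subrr mul0r.
  have [-> ->] := coefE k.
  by rewrite (g0 _ (@continuous_cos_scale _ _)) (g0 _ (@continuous_sin_scale _ _)) add0r.
apply/eqP; rewrite -subr_eq0; apply/eqP.
apply: (fourier_uniqueness cg _ _ s01) => k; have [ec es] := coefE k; have [cc cs] := coef k.
  by apply: (@addIr _ (a * (k == 0)%:R)); rewrite -ec cc add0r.
by rewrite -es.
Qed.
End TrigonometricMoments.

(** * Mellin integrals as Fourier coefficients *)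

Lemma continuous_mellin_integrand (R : realType) (chi T : R -> R) :
  (forall u, Rpos u -> {for u, continuous chi}) -> continuous T ->
  forall u, 0 < u -> {for u, continuous (fun u => chi u * T (ln u) / u)}.
Proof.
move=> cchi cT u u0; have cTln : {for u, continuous (T \o @ln R)}.
  by apply: continuous_comp; [exact: continuous_ln|exact: cT].
have cV : {for u, continuous (fun x : R => x^-1)} by apply: inv_continuous; rewrite gt_eqF.
have cc : {for u, continuous chi} by apply: cchi; exact/Rpos_gt0.
by apply: (continuousM (continuousM cc cTln) cV).
Qed.

Section Unfolding.
Variables (R : realType).
Local Notation mu := (@lebesgue_measure R).

Lemma expR_shift_derivable (c : R) :
  (forall x : R, derivable (fun s : R => expR (c + s)) x 1) /\
  (fun s : R => expR (c + s))^`()%classic = (fun s => expR (c + s)).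
Proof.
have d (x : R) : is_derive x 1 (fun s : R => expR (c + s)) (expR (c + x)).
  have d1 : is_derive x 1 (fun s : R => c + s) (0 + 1) by apply: is_deriveD.
  have := @is_derive1_comp R expR (fun s => c + s) x _ _ (is_derive_expR _) d1.
  by rewrite add0r mulr1.
split => [x|]; first exact: ex_derive.
by apply/funext => x; rewrite derive1E derive_val.
Qed.

Lemma continuous_expR_shift (c : R) : continuous (fun s : R => expR (c + s)).
Proof.
move=> x; apply: (@continuous_comp _ _ _ (fun s => c + s) expR); last exact: continuous_expR.
by apply: cvgD; [exact: cvg_cst|exact: cvg_id].
Qed.

(** This is the substitution [u = e^(c + s)]. The left interval is half-open so that consecutive
    pieces are disjoint. *)
Lemma integral_exp_piece (G : R -> R) (c : R) :
  (forall u, 0 < u -> {for u, continuous G}) ->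
  (\int[mu]_(u in `[expR c, expR (c + 1)%R[) (G u)%:E =
   \int[mu]_(s in `[0%R, 1%R]) (G (expR (c + s)) * expR (c + s))%:E)%E.
Proof.
move=> cG; have cG' : {within `[expR c, expR (c + 1)], continuous G}.
  apply: continuous_in_subspaceT => u; rewrite mem_setE in_itv/= => /andP[cu _].
  by apply: cG; rewrite (lt_le_trans (expR_gt0 c)).
rewrite integral_itv_bndo_bndc; last first.
  apply/measurable_EFinP; apply: (@measurable_funS _ _ _ _ `[expR c, expR (c + 1)]) => //.
    by move=> u /=; rewrite !in_itv/= => /andP[-> /ltW].
  exact: subspace_continuous_measurable_fun.
have [dF dFE] := expR_shift_derivable c; have cF := @continuous_expR_shift c.
rewrite -{1}(addr0 c).
rewrite (@integration_by_substitution_increasing _ (fun s => expR (c + s)) G 0 1) ?dFE//.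
- by move=> x y _ _ xy; rewrite ltr_expR ltrD2l.
- by apply/cvg_ex; exists (expR (c + 0)); apply: cvg_at_right_filter; exact: cF.
- by apply/cvg_ex; exists (expR (c + 1)); apply: cvg_at_left_filter; exact: cF.
- split; first by move=> x _; exact: dF.
  + by apply: cvg_at_right_filter; exact: cF.
  + by apply: cvg_at_left_filter; exact: cF.
- by rewrite addr0.
Qed.

Variables (chi : R -> R) (sg : nat -> int).
Hypotheses (chiK : is_kernel chi) (chi0 : forall u, 1 <= u < expR 1 -> chi u = 0)
  (cchi : forall u, Rpos u -> {for u, continuous chi})
  (sg_inj : injective sg) (sg_ge : forall n, (n <= `|sg n|)%N).

Let phi n (s : R) := chi (expR (- (sg n)%:~R) * expR s).

(** With [sg n = n + 1] this is the sum of [chi(e^(s - k))] over [k >= 1], with [sg n = - n] the sum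
    over [k <= 0]; a general [sg] treats [psi_minus] and [psi_plus] together. *)
Definition periodization (s : R) : R := limn (series (phi^~ s)).

Let continuous_phi n : continuous (phi n).
Proof.
move=> s; apply: (@continuous_comp _ _ _ (fun s => expR (- (sg n)%:~R) * expR s) chi).
  by apply: cvgM; [exact: cvg_cst|exact: continuous_expR].
by apply: cchi; apply/Rpos_gt0; rewrite mulr_gt0 ?expR_gt0.
Qed.

Let cvg_phi s : cvgn (series (phi^~ s)).
Proof.
have [A [_ sumA]] := kernel_sum chiK chi0.
exact: (proj1 (is_cvg_series_bounded (sumA _ (expR_gt0 s) _ sg_inj))).
Qed.

(** Locally uniform convergence: for [n >= N] and [|s - s0| < 1] the index [sg n] is at distance at
    least [g] from [s], so the moment bound leaves at most [M / g^nu <= e] for the tail. *)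
Lemma periodization_tail (e s0 : R) : 0 < e -> exists N, forall s, `|s - s0| < 1 ->
  `|periodization s - \sum_(n < N) phi n s| <= e.
Proof.
move=> e0; have [nu [M [nu0 M0 momM]]] := kernel_moment chiK.
pose g := (M / e + 1) `^ nu^-1.
have Me0 : 0 < M / e + 1 by rewrite ltr_wpDl// divr_ge0// ltW.
have g0 : 0 < g by exact: powR_gt0.
have gnu : g `^ nu = M / e + 1 by rewrite -powRrM mulVf ?gt_eqF// powRr1// ltW.
pose N := Num.bound (g + 1 + `|s0|).
have NP : g + 1 + `|s0| < N%:R by rewrite archi_boundP// !addr_ge0// ltW.
exists N => s ss0.
have -> : periodization s - \sum_(n < N) phi n s = limn (series (fun n => phi (n + N)%N s)).
  apply/esym/cvg_lim => //.
  rewrite (_ : series _ = (fun n => series (phi^~ s) (n + N)%N - \sum_(n < N) phi n s)).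
    by apply: cvgB; [rewrite (cvg_shiftn N (series (phi^~ s)))|exact: cvg_cst].
  apply/funext => n; rewrite series_addn [in RHS]/series/= big_mkord addrAC subrr add0r.
  by rewrite /series/= -{2}(add0n N) big_addn addnK.
apply: (proj2 (@is_cvg_series_bounded R _ e _)) => K.
have gN n : g `^ nu <= `|(sg (n + N)%N)%:~R - ln (expR s)| `^ nu.
  apply: ge0_ler_powR; rewrite ?nnegrE ?(ltW nu0) ?(ltW g0)// expRK.
  have : N%:R <= `|(sg (n + N)%N)%:~R| :> R.
    by rewrite -intr_norm -abszE -pmulrn ler_nat; apply: leq_trans (sg_ge _); exact: leq_addl.
  have k_tri (k : R) : `|k| <= `|k - s| + `|s| by rewrite -{1}(subrK s k) ler_normD.
  have s_tri : `|s| <= `|s - s0| + `|s0| by rewrite -{1}(subrK s0 s) ler_normD.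
  by move=> Nsg; have := k_tri (sg (n + N)%N)%:~R; lra.
have inj : injective (fun n => sg (n + N)%N) by move=> a b /sg_inj /addIn.
have gpos : 0 < g `^ nu by rewrite gnu.
rewrite -(ler_pM2r gpos) mulr_suml.
apply: (@le_trans _ _ M); last first.
  by rewrite gnu mulrDr mulr1 mulrCA mulfV ?gt_eqF// mulr1 lerDl ltW.
apply: le_trans (momM _ (expR_gt0 s) _ inj K); apply: ler_sum => i _.
by rewrite ler_wpM2l.
Qed.

Lemma continuous_periodization : continuous periodization.
Proof.
move=> s0; apply/cvgrPdist_le => e e0.
have e30 : 0 < e / 3 by rewrite divr_gt0.
have [N NP] := periodization_tail s0 e30.
have cS : continuous (fun s => \sum_(n < N) phi n s).
  by apply: continuous_big => [|n _]; [exact: add_continuous|exact: continuous_phi].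
near=> s.
have ss0 : `|s - s0| < 1.
  by rewrite distrC; near: s; exact: (@nbhsx_ballx _ _ s0 1 ltr01).
have d1 := NP s ss0.
have d2 : `|periodization s0 - \sum_(n < N) phi n s0| <= e / 3 by apply: NP; rewrite subrr normr0.
have d3 : `|\sum_(n < N) phi n s0 - \sum_(n < N) phi n s| <= e / 3.
  by near: s; move: (cS s0) => /cvgrPdist_le; apply.
move: d1 d2 d3; rewrite !ler_norml => /andP[? ?] /andP[? ?] /andP[? ?].
by apply/andP; split; lra.
Unshelve. all: by end_near. Qed.

Let piece n : set R := `[expR (- (sg n)%:~R), expR (- (sg n)%:~R + 1)[.

(** A point [u] of the piece [n] determines [sg n] as [- floor (ln u)], and [sg] is injective. *)
Lemma trivIset_piece : trivIset [set: nat] piece.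
Proof.
have pieceP n u : piece n u -> - sg n = Num.floor (ln u).
  rewrite /piece/= in_itv/= => /andP[su us].
  have u0 : 0 < u by rewrite (lt_le_trans (expR_gt0 _) su).
  apply/esym/eqP; rewrite floor_eq intrD1 rmorphN/=.
  by rewrite -ler_expR -ltr_expR lnK// su.
move=> m n _ _ [u [/pieceP um /pieceP un]].
by apply/sg_inj/oppr_inj; rewrite um un.
Qed.

Variable T : R -> R.
Hypotheses (cT : continuous T) (T_le1 : forall s, `|T s| <= 1)
  (T_per : forall (s : R) (k : int), T (s + k%:~R) = T s).

Let G u := chi u * T (ln u) / u.

Let continuous_G (u : R) : 0 < u -> {for u, continuous G}.
Proof. exact: continuous_mellin_integrand. Qed.

(** The Jacobian of the substitution cancels [1 / u], and the period 1 of [T] absorbs the integer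
    [- sg n]. *)
Let G_exp n s : G (expR (- (sg n)%:~R + s)) * expR (- (sg n)%:~R + s) = phi n s * T s.
Proof.
rewrite /G divfK ?gt_eqF ?expR_gt0// expRK [in LHS]expRD; congr (_ * _).
by rewrite addrC -rmorphN T_per.
Qed.

Let measurable_piece n : measurable (piece n).
Proof. exact: measurable_itv. Qed.

Let measurable_G : measurable_fun (\bigcup_n piece n) G.
Proof.
apply: (@measurable_funS _ _ _ _ (@Rpos R)) => //.
- exact: measurable_itv.
- by move=> u [n _]; rewrite /piece/= in_itv/= => /andP[su _]; apply/Rpos_gt0; rewrite (lt_le_trans (expR_gt0 _) su).
- apply: (@subspace_continuous_measurable_fun R (@Rpos R) G); first exact: measurable_itv.
  apply: continuous_in_subspaceT => u; rewrite inE => /Rpos_gt0.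
  exact: continuous_G.
Qed.

Let continuous_phiT n : continuous (fun s => phi n s * T s).
Proof. by apply: continuousM_fun; [exact: continuous_phi|exact: cT]. Qed.

Let sum_phiT_le : exists A : R, forall N s, \sum_(n < N) `|phi n s * T s| <= A.
Proof.
have [A [_ sumA]] := kernel_sum chiK chi0; exists A => N s.
apply: le_trans (sumA _ (expR_gt0 s) _ sg_inj N); apply: ler_sum => n _.
by rewrite normrM ler_piMr.
Qed.

(** After substitution on each piece, the partial sums of the absolute values are at most [A]
    pointwise, hence at most [A] after integration over [[0, 1]]. *)
Lemma integrable_unfold : mu.-integrable (\bigcup_n piece n) (EFin \o G).
Proof.
have [A sumA] := sum_phiT_le.
apply/integrableP; split; first exact/measurable_EFinP.
rewrite ge0_integral_bigcup//; last 2 first.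
- apply: measurableT_comp => //; exact/measurable_EFinP.
- exact: trivIset_piece.
rewrite (@eq_eseriesr _ _ (fun n => \int[mu]_(s in `[0%R, 1%R]) `|phi n s * T s|%:E)%E); last first.
  move=> n _; rewrite (@integral_exp_piece (fun u => `|G u|)).
    apply: eq_integral => s _; congr EFin.
    by rewrite -[X in _ * X]ger0_norm ?expR_ge0// -normrM G_exp.
  by move=> u u0; apply: cvg_norm; exact: continuous_G.
apply: (@le_lt_trans _ _ A%:E); last exact: ltry.
apply: lime_le; first by apply: is_cvg_nneseries => n _ _; exact: integral_ge0.
apply: nearW => N.
rewrite -ge0_integral_sum//; last first.
  by move=> n; apply/measurable_EFinP; apply: measurableT_comp => //;
    apply: measurable_funTS; exact: continuous_measurable_fun.
apply: (@le_trans _ _ (\int[mu]_(s in `[0%R, 1%R]) (cst A%:E s))%E).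
  apply: ge0_le_integral => //.
  - by move=> s _; exact: sume_ge0.
  - apply: emeasurable_sum => n; apply/measurable_EFinP; apply: measurableT_comp => //.
    by apply: measurable_funTS; exact: continuous_measurable_fun.
  - by move=> s _; rewrite sumEFin lee_fin big_mkord.
rewrite integral_cst//=; have := lebesgue_measure_itv `[0 : R, 1]; rewrite /= => ->.
by rewrite lte_fin ltr01 sube0 mule1.
Qed.

(** Countable additivity over the pieces gives a series of integrals over [[0, 1]]; dominated
    convergence, with the constant [A] as dominating function, exchanges sum and integral. *)
Lemma integral_unfold :
  (\int[mu]_(u in \bigcup_n piece n) (G u)%:E =
   \int[mu]_(s in `[0%R, 1%R]) (periodization s * T s)%:E)%E.
Proof.
have [A sumA] := sum_phiT_le.
rewrite integral_bigcup//; last 2 first.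
- exact: trivIset_piece.
- exact: integrable_unfold.
rewrite (@eq_eseriesr _ _ (fun n => \int[mu]_(s in `[0%R, 1%R]) (phi n s * T s)%:E)%E); last first.
  move=> n _; rewrite integral_exp_piece; last exact: continuous_G.
  by apply: eq_integral => s _; rewrite G_exp.
have mS N : measurable_fun `[0 : R, 1] (fun s => \sum_(0 <= n < N) phi n s * T s).
  by apply: measurable_sum => n; apply: measurable_funTS; exact: continuous_measurable_fun.
have sumE N s : \sum_(0 <= n < N) phi n s * T s = series (phi^~ s) N * T s.
  by rewrite /series/= mulr_suml.
have [|||||_ _ dom] := @dominated_convergence _ _ _ mu `[0 : R, 1] (measurable_itv _)
  (fun N s => (\sum_(0 <= n < N) phi n s * T s)%:E)
  (fun s => (periodization s * T s)%:E) (cst A%:E).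
- by move=> N; apply/measurable_EFinP; exact: mS.
- apply/measurable_EFinP; apply: measurable_funTS; apply: continuous_measurable_fun.
  by apply: continuousM_fun => //; exact: continuous_periodization.
- apply: aeW => s _; apply/fine_cvgP; split; first exact: nearW.
  rewrite (_ : fine \o _ = (fun N => series (phi^~ s) N * T s)); last first.
    by apply/funext => N /=; rewrite sumE.
  by apply: cvgM; [exact: cvg_phi|exact: cvg_cst].
- by apply: (@continuous_integrable_itv _ (fun=> A)); exact: cst_continuous.
- apply: aeW => s N _; rewrite /= lee_fin (le_trans (ler_norm_sum _ _ _))//.
  by rewrite big_mkord.
apply/cvg_lim => //; apply: cvg_trans dom; apply: near_eq_cvg; apply: nearW => N.
rewrite /= -(@integral_sum _ _ _ mu `[0 : R, 1] (measurable_itv _) _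
  (fun n s => (phi n s * T s)%:E)).
  by apply: eq_integral => s _; rewrite sumEFin.
by move=> n; exact: (continuous_integrable_itv _ _ (@continuous_phiT n)).
Qed.
End Unfolding.

(** * Real form of the Mellin coefficients; one-sided sums as periodizations *)

Section MellinCoefficients.
Variables (R : realType) (chi : R -> R).
Hypotheses (chiK : is_kernel chi) (chi0 : forall u, 1 <= u < expR 1 -> chi u = 0).

Lemma mellin_coefE (D : set R) (k : int) : D `<=` @Rpos R ->
  mellin_coef D chi k =
  (lebint D (fun u => chi u * cos (2 * k%:~R * pi * ln u) / u) +i*
   lebint D (fun u => chi u * sin (2 * k%:~R * pi * ln u) / u))%C.
Proof.
move=> DR; have E (u : R) : 0 < u -> ((chi u)%:C * cpow u (0 +i* (2 * k%:~R * pi)) / u%:C)%C =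
   ((chi u * cos (2 * k%:~R * pi * ln u) / u) +i* (chi u * sin (2 * k%:~R * pi * ln u) / u))%C.
  move=> u0; rewrite -(fmorphV (real_complex R)) /cpow /cexp /=.
  simpc.
  by rewrite expR0 ?mul1r ?mul0r.
rewrite /mellin_coef /lebintC; congr (_ +i* _)%C; rewrite /lebint.
  by apply: eq_Rintegral => u; rewrite inE => /DR/Rpos_gt0 u0; rewrite E.
by apply: eq_Rintegral => u; rewrite inE => /DR/Rpos_gt0 u0; rewrite E.
Qed.

Lemma lim_series_recl (b : nat -> R) : b 0%N = 0 -> cvgn (series b) ->
  limn (series (fun n => b n.+1)) = limn (series b).
Proof.
move=> b0 cb; apply/cvg_lim => //.
rewrite (_ : series _ = (fun n => series b n.+1)); first by rewrite (cvg_shiftS (series b)).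
by apply/funext => n; rewrite /series/= [RHS]big_nat_recl//= b0 add0r.
Qed.

Let kp (n : nat) : int := Posz n.+1.
Let kn (n : nat) : int := - Posz n.

(** For [0 <= s < 1], the condition [k > s] means [k >= 1], so the index 0 and the whole negative
    half contribute nothing. *)
Lemma psi_minus_periodization s : 0 <= s < 1 ->
  psi_minus chi (expR s) = periodization chi kp s.
Proof.
move=> /andP[s0 s1]; have [cp cn] := cvg_psi chiK chi0 (fun k => ln (expR s) < k%:~R) (expR_gt0 s).
rewrite /psi_minus /zsum -lim_series_recl//; last by rewrite expRK ltNge s0.
have -> : (fun n => if ln (expR s) < (Negz n)%:~R then chi (expR s * expR (- (Negz n)%:~R)) else 0) = (fun=> 0).
  apply/funext => n; rewrite expRK ltNge (le_trans _ s0)//.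
rewrite /periodization (_ : series (fun=> 0) = fun=> 0); last first.
  by apply/funext => n; rewrite /series/= big1.
rewrite lim_cst// addr0; congr (limn (series _)); apply/funext => n.
rewrite expRK mulrC (lt_le_trans s1)//.
by rewrite ler1z.
Qed.

(** The condition [k < s] allows [k = 0] only when [s > 0], but the term of index 0 is
    [chi(e^s) = 0] in either case; what remains is the negative half. *)
Lemma psi_plus_periodization s : 0 <= s < 1 ->
  psi_plus chi (expR s) = periodization chi kn s.
Proof.
move=> /andP[s0 s1]; have [cp cn] := cvg_psi chiK chi0 (fun k => k%:~R < ln (expR s)) (expR_gt0 s).
pose b n := chi (expR (- (kn n)%:~R) * expR s).
have b0 : b 0%N = 0.
  rewrite /b /kn oppr0 expR0 mul1r chi0//.
  by rewrite -{1}expR0 ler_expR ltr_expR s0.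
have bS : (fun n => b n.+1) = (fun n => if (Negz n)%:~R < ln (expR s) then chi (expR s * expR (- (Negz n)%:~R)) else 0).
  apply/funext => n; rewrite expRK (lt_le_trans _ s0) /b /kn ?NegzE 1?mulrC//.
  by rewrite ltrz0.
have -> : periodization chi kn s = limn (series (fun n => b n.+1)).
  rewrite lim_series_recl//.
  have [A [_ sumA]] := kernel_sum chiK chi0.
  apply: (proj1 (is_cvg_series_bounded (sumA _ (expR_gt0 s) kn _))).
  by move=> i j /oppr_inj /eqP; rewrite eqz_nat => /eqP.
rewrite bS /psi_plus /zsum -[RHS]add0r; congr (_ + _).
rewrite (_ : series _ = fun=> 0) ?lim_cst//; apply/funext => n; rewrite /series/= big1// => i _.
rewrite expRK; case: ifPn => // iS.
have i0 : i = 0%N.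
  have : i%:R < 1 :> R by rewrite (lt_trans _ s1)// pmulrn.
  by rewrite (ltr_nat R i 1) ltnS leqn0 => /eqP.
by move: iS; rewrite i0 oppr0 expR0 mulr1 => _; rewrite chi0// -{1}expR0 ler_expR ltr_expR s0.
Qed.

End MellinCoefficients.

(** * Constancy of a periodization read on Mellin coefficients *)

Section MellinUnfolding.
Variables (R : realType) (chi : R -> R) (sg : nat -> int).
Hypotheses (chiK : is_kernel chi) (chi0 : forall u, 1 <= u < expR 1 -> chi u = 0)
  (cchi : forall u, Rpos u -> {for u, continuous chi})
  (sg_inj : injective sg) (sg_ge : forall n, (n <= `|sg n|)%N).

Lemma measurable_mellin_integrand (D : set R) (T : R -> R) : continuous T ->
  D `<=` @Rpos R -> measurable_fun D (fun u => chi u * T (ln u) / u).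
Proof.
move=> cT DR; apply: (@measurable_funS _ _ _ _ (@Rpos R)) => //.
  exact: measurable_itv.
apply: (@subspace_continuous_measurable_fun R (@Rpos R)); first exact: measurable_itv.
apply: continuous_in_subspaceT => u; rewrite inE => Ru.
exact: continuous_mellin_integrand cchi cT _ (proj1 (Rpos_gt0 u) Ru).
Qed.

Lemma lebint_unfold (D : set R) (T : R -> R) : measurable D -> continuous T ->
  (forall s, `|T s| <= 1) -> (forall (s : R) (k : int), T (s + k%:~R) = T s) ->
  D = \bigcup_n `[expR (- (sg n)%:~R), expR (- (sg n)%:~R + 1)[%classic ->
  lebint D (fun u => chi u * T (ln u) / u) =
  \int[lebesgue_measure]_(s in `[0, 1]) (periodization chi sg s * T s).
Proof.
move=> mD cT T1 Tper DE; rewrite lebint_Borel//; last first.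
  apply: measurable_mellin_integrand => // u; rewrite DE => -[n _] /=.
  by rewrite in_itv/= => /andP[su _]; apply/Rpos_gt0; rewrite (lt_le_trans (expR_gt0 _) su).
by rewrite /Rintegral DE (integral_unfold chiK chi0 cchi sg_inj sg_ge cT T1 Tper).
Qed.

Lemma mellin_coef_unfold (D : set R) (k : int) : measurable D ->
  D = \bigcup_n `[expR (- (sg n)%:~R), expR (- (sg n)%:~R + 1)[%classic ->
  mellin_coef D chi k =
  (\int[lebesgue_measure]_(s in `[0, 1]) (periodization chi sg s * cos (2 * k%:~R * pi * s)) +i*
   \int[lebesgue_measure]_(s in `[0, 1]) (periodization chi sg s * sin (2 * k%:~R * pi * s)))%C.
Proof.
move=> mD DE; rewrite mellin_coefE; last first.
  move=> u; rewrite DE => -[n _] /=; rewrite in_itv/= => /andP[su _].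
  by apply/Rpos_gt0; rewrite (lt_le_trans (expR_gt0 _) su).
have shiftE (s : R) (j : int) : 2 * k%:~R * pi * (s + j%:~R) =
    2 * k%:~R * pi * s + 2 * (k * j)%:~R * pi by rewrite rmorphM/=; ring.
congr (_ +i* _)%C; apply: (@lebint_unfold D _ mD _ _ _ DE).
- exact: continuous_cos_scale.
- by move=> s; rewrite ler_norml cos_geN1 cos_le1.
- by move=> s j; rewrite shiftE; have [-> _] := cos_sin_2pi_int (2 * k%:~R * pi * s) (k * j).
- exact: continuous_sin_scale.
- by move=> s; rewrite ler_norml sin_geN1 sin_le1.
- by move=> s j; rewrite shiftE; have [_ ->] := cos_sin_2pi_int (2 * k%:~R * pi * s) (k * j).
Qed.

Lemma mellin_coefP (D : set R) (a : R) : measurable D ->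
  D = \bigcup_n `[expR (- (sg n)%:~R), expR (- (sg n)%:~R + 1)[%classic ->
  (forall k, mellin_coef D chi k = if k == 0 then (a%:C)%C else 0) <->
  (forall s, 0 <= s < 1 -> periodization chi sg s = a).
Proof.
move=> mD DE.
have cP := continuous_periodization chiK chi0 cchi sg_inj sg_ge.
rewrite (fourier_constantP _ cP).
have E k : (if k == 0 then (a%:C)%C else 0) = (a * (k == 0)%:R +i* 0)%C.
  by case: eqP => _; rewrite ?mulr1 ?mulr0.
split=> coef k; have := coef k.
  by rewrite mellin_coef_unfold// E => -[].
by rewrite mellin_coef_unfold// E => -[-> ->].
Qed.
End MellinUnfolding.

(** * Partitions of [[1, oo)] and [(0, 1)] into exponential pieces *)

Lemma bigcup_piece_ge1 (R : realType) :
  `[1, +oo[%classic = \bigcup_n `[expR (- (- Posz n)%:~R), expR (- (- Posz n)%:~R + 1)[%classic :> set R.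
Proof.
apply/seteqP; split => [u|u [n _]] /=; rewrite !in_itv/=.
  rewrite andbT => u1; have u0 : 0 < u by rewrite (lt_le_trans ltr01).
  have : 0 <= Num.floor (ln u) by rewrite floor_ge0 ln_ge0.
  case E : (Num.floor (ln u)) => [n|//] _; exists n => //=.
  rewrite in_itv/= rmorphN/= opprK -{1}[X in _ <= X < _](lnK u0) -[X in _ && (X < _)](lnK u0).
  rewrite ler_expR ltr_expR -E; apply/andP; split; first exact: floor_le.
  by rewrite -intrD1 floorD1_gt.
rewrite rmorphN/= opprK => /andP[nu _]; rewrite andbT (le_trans _ nu)//.
by rewrite -{1}expR0 ler_expR ler0z.
Qed.

Lemma bigcup_piece_lt1 (R : realType) :
  `]0, 1[%classic = \bigcup_n `[expR (- (Posz n.+1)%:~R), expR (- (Posz n.+1)%:~R + 1)[%classic :> set R.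
Proof.
apply/seteqP; split => [u|u [n _]] /=; rewrite !in_itv/=.
  move=> /andP[u0 u1].
  have : Num.floor (ln u) < 0 by rewrite floor_lt0 ln_lt0// u0.
  case E : (Num.floor (ln u)) => [//|n] _; exists n => //=.
  have E' : - (Posz n.+1)%:~R = (Num.floor (ln u))%:~R :> R by rewrite E NegzE mulrNz.
  rewrite in_itv/= E' -{2}(lnK u0) ler_expR floor_le/= -{1}(lnK u0) ltr_expR.
  by rewrite -intrD1 floorD1_gt.
move=> /andP[nu un]; rewrite (lt_le_trans (expR_gt0 _) nu)/= (lt_le_trans un)//.
rewrite -[leRHS]expR0 ler_expR addrC subr_le0.
by rewrite ler1z.
Qed.

(** The pieces with [k >= 1] cover [(0, 1)] without the point 1 of the domain in (iv), a null
    set. *)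
Lemma mellin_coef_oc (R : realType) (chi : R -> R) (k : int) :
  (forall u, Rpos u -> {for u, continuous chi}) ->
  mellin_coef `]0, 1] chi k = mellin_coef `]0, 1[ chi k.
Proof.
move=> cchi.
have oc : `]0, 1]%classic `<=` @Rpos R.
  by move=> u /=; rewrite in_itv/= => /andP[u0 _]; exact/Rpos_gt0.
have oo : `]0, 1[%classic `<=` @Rpos R.
  by move=> u /=; rewrite in_itv/= => /andP[u0 _]; exact/Rpos_gt0.
rewrite !mellin_coefE//.
have eq_lebint (T : R -> R) : continuous T ->
    lebint `]0, 1] (fun u => chi u * T (ln u) / u) = lebint `]0, 1[ (fun u => chi u * T (ln u) / u).
  move=> cT; have m (D : set R) : D `<=` @Rpos R -> measurable_fun D (fun u => chi u * T (ln u) / u).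
    exact: measurable_mellin_integrand.
  rewrite !lebint_Borel//; [|exact: m|exact: m].
  by rewrite /Rintegral integral_itv_bndo_bndc//; apply/measurable_EFinP; exact: m.
congr (_ +i* _)%C.
  exact: (eq_lebint _ (@continuous_cos_scale R (2 * k%:~R * pi))).
exact: (eq_lebint _ (@continuous_sin_scale R (2 * k%:~R * pi))).
Qed.

Unset Implicit Arguments.

(** At [t = 1] every [t^w] equals 1, so (i) constrains [psi_minus] only at 1; this is why the
    passage from (i) to (ii) asks for [t <> 1]. *)
Theorem theorem5 (R : realType) (f : R -> R) (t : R)
  (f_bounded : [bounded f x | x in @Rpos R])
  (f_measurable : lebesgue_measurable_fun (@Rpos R) f)
  (t_pos : Rpos t) (t_jump : jump_discontinuity f t)
  (alpha : R) (chi : R -> R) (chi_kernel : is_kernel chi)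
  (chi0 : forall u, 1 <= u < expR 1 -> chi u = 0) :
  let i := Kantorovich chi f w t @[w --> +oo] -->
             alpha * right_lim f t + (1 - alpha) * left_lim f t in
  let ii := forall u, 1 <= u < expR 1 -> psi_minus chi u = alpha in
  let iii := forall u, 1 <= u < expR 1 -> psi_plus chi u = 1 - alpha in
  let iv := forall k : int, mellin_coef `]0, 1] chi k =
              if k == 0 then (alpha%:C)%C else 0 in
  let v := forall k : int, mellin_coef `[1, +oo[ chi k =
              if k == 0 then ((1 - alpha)%:C)%C else 0 in
  [/\ t <> 1 -> i -> ii,
      ii -> i,
      ii <-> iii
    & (forall u, Rpos u -> {for u, continuous chi}) -> (ii <-> iv) /\ (ii <-> v)].
Proof.
move=> i ii iii iv v.
have ii_iii : ii <-> iii.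
  have sum1 u : 1 <= u < expR 1 -> psi_minus chi u + psi_plus chi u = 1.
    by move=> /andP[u1 _]; apply: psi_sum1 => //; rewrite (lt_le_trans ltr01).
  split=> psiE u u1; have := sum1 u u1; rewrite psiE// => E.
    by rewrite -E addrAC subrr add0r.
  by apply: (@addIr _ (1 - alpha)); rewrite E; ring.
(* The change of variable [u = e^s] turns [[1, e)] into the period [[0, 1)]. *)
have exp_itv (p : R -> R) (a : R) : (forall u, 1 <= u < expR 1 -> p u = a) <->
    (forall s, 0 <= s < 1 -> p (expR s) = a).
  split=> pa s s01.
    by apply: pa; rewrite -{1}expR0 ler_expR ltr_expR.
  have s0 : 0 < s by case/andP: s01 => s1 _; rewrite (lt_le_trans ltr01).
  by rewrite -(lnK s0) pa// -ler_expR -ltr_expR expR0 lnK.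
split=> //.
- exact: Kantorovich_psi_minus_limit.
- exact: psi_minus_Kantorovich.
move=> cchi; split.
  rewrite /iv; under eq_forall do rewrite mellin_coef_oc//.
  rewrite (mellin_coefP chi_kernel chi0 cchi (sg := fun n => Posz n.+1) _ _ _ _ (bigcup_piece_lt1 R)).
  - rewrite /ii exp_itv; split=> + s s01 => /(_ s s01).
      by rewrite (psi_minus_periodization chi_kernel chi0 s01).
    by rewrite (psi_minus_periodization chi_kernel chi0 s01).
  - by move=> m n [].
  - by move=> n.
  - exact: measurable_itv.
(* The domain [u >= 1] corresponds to the indices [k <= 0], that is to [psi_plus], so (v) is reached
   through (iii). *)
rewrite ii_iii /v.
rewrite (mellin_coefP chi_kernel chi0 cchi (sg := fun n => - Posz n) _ _ _ _ (bigcup_piece_ge1 R)).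
- rewrite /iii exp_itv; split=> + s s01 => /(_ s s01).
    by rewrite (psi_plus_periodization chi_kernel chi0 s01).
  by rewrite (psi_plus_periodization chi_kernel chi0 s01).
- by move=> m n /oppr_inj /eqP; rewrite eqz_nat => /eqP.
- by move=> n; rewrite abszN.
- exact: measurable_itv.
Qed.
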